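(* Let $1<p\le q<\infty$. Then $\mathcal K(c_0(l_p),l_q)$ contains no subspace isomorphic to $\mathcal K(c_0)$.
   Context: $l_p$ is the classical Banach space of $p$-summable real sequences, $c_0$ the space of real null sequences, and $c_0(X)$ is the Banach space of sequences $(x_n)$ in $X$ with $\|x_n\|\to0$, with the supremum norm. $\mathcal K(X,Y)$ is the Banach space of compact operators from $X$ to $Y$ with the operator norm, and $\mathcal K(X)=\mathcal K(X,X)$. ''Isomorphic'' means linearly homeomorphic. *)

(* Defs.v *)
From HB Require Import structures.
From mathcomp Require Import all_boot all_order all_algebra.
From mathcomp Require Import all_classical all_reals all_analysis.

Set Implicit Arguments.
Unset Strict Implicit.
Unset Printing Implicit Defensive.

Import Order.TTheory GRing.Theory Num.Theory.
Import numFieldNormedType.Exports.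

Local Open Scope classical_set_scope.
Local Open Scope ring_scope.

Section lp.
Context {R : realType}.
Implicit Types (p : R) (x y : nat -> R).

Definition psummable p : {pred nat -> R} :=
  [pred x | `[< cvgn (series (fun n => `|x n| `^ p)) >]].

Definition lp_norm p x : R := limn (series (fun n => `|x n| `^ p)) `^ p^-1.

Local Notation N p x := ('N[counting]_p%:E[EFin \o x])%E.

Lemma lim_powser_ge0 p x : x \in psummable p ->
  0 <= limn (series (fun n => `|x n| `^ p)).
Proof.
move=> /asboolP cx; apply: limr_ge => //; apply: nearW => n.
by rewrite /series/=; apply: sumr_ge0 => i _; exact: powR_ge0.
Qed.

Lemma Lnorm_lp_norm p x : 1 <= p -> x \in psummable p ->
  N p x = (lp_norm p x)%:E.
Proof.
move=> p1 xp; have p0 : 0 < p by rewrite (lt_le_trans ltr01).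
have /asboolP cx := xp.
rewrite Lnorm_counting// /lp_norm -poweR_EFin; congr (_ `^ _)%E.
rewrite -EFin_lim//; congr (limn _); apply/funext => n /=.
by rewrite /series/= -sumEFin; apply: eq_bigr.
Qed.

Lemma psummable_Lnorm p x : 1 <= p ->
  (x \in psummable p) = (N p x < +oo)%E.
Proof.
move=> p1; have p0 : 0 < p by rewrite (lt_le_trans ltr01).
apply/idP/idP => [xp|]; first by rewrite Lnorm_lp_norm// ltry.
rewrite Lnorm_counting// => Nx; apply/asboolP.
apply: nnseries_is_cvg => [n|]; first exact: powR_ge0.
by apply: lty_poweRy Nx; rewrite invr_eq0 gt_eqF.
Qed.

Lemma minkowski_lp p x y : 1 <= p -> (N p (x + y)%R <= N p x + N p y)%E.
Proof. by move=> p1; apply: minkowski_EFin. Qed.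

Lemma psummableZ_lim p (a : R) x : x \in psummable p ->
  series (fun n => `|(a *: x) n| `^ p) @ \oo -->
  `|a| `^ p * limn (series (fun n => `|x n| `^ p)).
Proof.
move=> /asboolP cx.
have -> : series (fun n => `|(a *: x) n| `^ p)
    = (fun n => `|a| `^ p * series (fun n => `|x n| `^ p) n).
  apply/funext => n; rewrite /series/= mulr_sumr; apply: eq_bigr => i _.
  by rewrite -powRM// -normrM.
exact: cvgMr.
Qed.

Fact psummable_submod_closed p : 1 <= p -> submod_closed (psummable p).
Proof.
move=> p1; have p0 : 0 < p by rewrite (lt_le_trans ltr01).
split.
  rewrite psummable_Lnorm// (_ : _ \o _ = cst 0%E)// Lnorm0//.
  by rewrite eqe gt_eqF.
move=> a x y xp yp; rewrite psummable_Lnorm//.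
apply: le_lt_trans (minkowski_lp _ _ p1) _.
have axp : a *: x \in psummable p.
  by apply/asboolP; apply: cvgP (@psummableZ_lim p a x xp).
have Nax : (N p (a *: x) < +oo)%E by rewrite -(psummable_Lnorm _ p1); exact: axp.
have Ny : (N p y < +oo)%E by rewrite -(psummable_Lnorm _ p1); exact: yp.
exact: lte_add_pinfty Nax Ny.
Qed.

Lemma lp_normD p x y : 1 <= p ->
  x \in psummable p -> y \in psummable p -> x + y \in psummable p ->
  lp_norm p (x + y) <= lp_norm p x + lp_norm p y.
Proof.
move=> p1 xp yp xyp; have := minkowski_lp x y p1.
have -> := Lnorm_lp_norm p1 xp; have -> := Lnorm_lp_norm p1 yp.
by have -> := Lnorm_lp_norm p1 xyp.
Qed.

End lp.

(* p1 is not used in the carrier, but the norm instance below needs it. *)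
Record lp {R : realType} (p : R) (p1 : 1 <= p) :=
  Lp { lp_seq :> nat -> R; _ : lp_seq \in psummable p }.

Section lp_normed.
Context {R : realType} (p : R) (p1 : 1 <= p).
Local Notation l := (lp p1).

HB.instance Definition _ := [isSub of l for @lp_seq R p p1].
HB.instance Definition _ := [Choice of l by <:].
HB.instance Definition _ := GRing.SubChoice_isSubLmodule.Build R _ _ l
  (psummable_submod_closed p1).

Fact ler_lp_normD (x y : l) : lp_norm p (x + y) <= lp_norm p x + lp_norm p y.
Proof. exact: lp_normD p1 (valP x) (valP y) (valP (x + y)). Qed.

Fact lp_normZ a (x : l) : lp_norm p (a *: x) = `|a| * lp_norm p x.
Proof.
have p0 : p != 0 by rewrite gt_eqF// (lt_le_trans ltr01).
have lx := @psummableZ_lim _ p a _ (valP x).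
have x0 := lim_powser_ge0 (valP x).
have -> : lp_norm p (a *: x) =
    (`|a| `^ p * limn (series (fun n => `|x n| `^ p))) `^ p^-1.
  by rewrite -(cvg_lim _ lx).
by rewrite powRM ?powR_ge0// -powRrM divff// powRr1.
Qed.

Fact lp_norm_eq0 (x : l) : lp_norm p x = 0 -> x = 0.
Proof.
move=> x0; apply/val_inj/funext => n /=; apply/eqP; rewrite -normr_eq0.
have /asboolP cx := valP x.
have l0 : limn (series (fun n => `|x n| `^ p)) = 0 by exact: powR_eq0_eq0 x0.
have xn : `|x n| `^ p <= 0.
  rewrite -l0; apply: (@le_trans _ _ (series (fun n => `|x n| `^ p) n.+1)).
    rewrite /series/= big_nat_recr//= lerDr.
    by apply: sumr_ge0 => i _; exact: powR_ge0.
  apply: nondecreasing_cvgn_le cx _.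
  by apply/nondecreasing_series => i _ _; exact: powR_ge0.
by apply/eqP/(@powR_eq0_eq0 _ _ p)/eqP; rewrite eq_le xn powR_ge0.
Qed.

HB.instance Definition _ :=
  Lmodule_isNormed.Build R l ler_lp_normD lp_normZ lp_norm_eq0.

End lp_normed.

Section null_seq.
Context {R : realType} {X : normedModType R}.
Implicit Types x y : nat -> X.

Definition null_seq : {pred nat -> X} :=
  [pred x | `[< `|x n| @[n --> \oo] --> (0 : R) >]].

Definition sup_norm x : R := sup (range (fun n => `|x n|)).

Fact null_seq_submod_closed : submod_closed null_seq.
Proof.
have nullP x : x \in null_seq <-> x @ \oo --> (0 : X).
  split=> [/asboolP x0|x0]; first by apply/norm_cvg0P.
  by apply/asboolP/norm_cvg0P.
split; first by apply/nullP; exact: cvg_cst.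
move=> a x y /nullP x0 /nullP y0; apply/nullP.
have ax0 : a *: x n @[n --> \oo] --> a *: (0 : X) by exact: cvgZr.
rewrite (_ : (0 : X) = a *: 0 + 0); last by rewrite scaler0 addr0.
exact: cvgD ax0 y0.
Qed.

Lemma null_seq_has_sup x : x \in null_seq -> has_sup (range (fun n => `|x n|)).
Proof.
move=> /asboolP x0; split; first by exists `|x 0%N|, 0%N.
have /cvg_seq_bounded/bounded_fun_has_ubound : cvgn (fun n => `|x n| : R^o).
  by apply: cvgP x0.
by [].
Qed.

Lemma ler_sup_norm x n : x \in null_seq -> `|x n| <= sup_norm x.
Proof.
by move=> /null_seq_has_sup[_ ub]; apply: ub_le_sup => //; exists n.
Qed.

Lemma sup_norm_le x (M : R) : (forall n, `|x n| <= M) -> sup_norm x <= M.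
Proof.
move=> xM; apply: ge_sup; first by exists `|x 0%N|, 0%N.
by move=> _ [n _ <-].
Qed.

End null_seq.

Record c0 {R : realType} (X : normedModType R) :=
  C0 { c0_seq :> nat -> X; _ : c0_seq \in null_seq }.

Section c0_normed.
Context {R : realType} (X : normedModType R).

HB.instance Definition _ := [isSub of c0 X for @c0_seq R X].
HB.instance Definition _ := [Choice of c0 X by <:].
HB.instance Definition _ := GRing.SubChoice_isSubLmodule.Build R _ _ (c0 X)
  null_seq_submod_closed.

Fact ler_c0_normD (x y : c0 X) : sup_norm (x + y) <= sup_norm x + sup_norm y.
Proof.
apply: sup_norm_le => n; apply: le_trans (ler_normD _ _) _.
by apply: lerD; apply: ler_sup_norm; exact: valP.
Qed.

Fact c0_normZ a (x : c0 X) : sup_norm (a *: x) = `|a| * sup_norm x.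
Proof.
have le b (y : c0 X) : sup_norm (b *: y) <= `|b| * sup_norm y.
  apply: sup_norm_le => n; rewrite [leLHS]normrZ.
  by apply: ler_wpM2l => //; apply: ler_sup_norm; exact: valP.
have [->|a0] := eqVneq a 0.
  apply/eqP; rewrite eq_le le/= normr0 mul0r.
  exact: le_trans (normr_ge0 _) (ler_sup_norm 0%N (valP (0 *: x))).
apply/eqP; rewrite eq_le le/= -ler_pdivlMl ?normr_gt0// -normfV.
by have := le a^-1 (a *: x); rewrite scalerA mulVf// scale1r.
Qed.

Fact c0_norm_eq0 (x : c0 X) : sup_norm x = 0 -> x = 0.
Proof.
move=> x0; apply/val_inj/funext => n /=; apply/eqP; rewrite -normr_eq0.
by rewrite eq_le normr_ge0 andbT -x0; apply: ler_sup_norm; exact: valP.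
Qed.

HB.instance Definition _ :=
  Lmodule_isNormed.Build R (c0 X) ler_c0_normD c0_normZ c0_norm_eq0.

End c0_normed.

Section compact_operator.
Context {R : realType} {X Y : normedModType R}.
Implicit Types f g : X -> Y.

Definition unit_ball : set X := [set x | `|x| <= 1].

Definition compact_operator : {pred X -> Y} :=
  [pred f | `[< linear f /\ precompact (f @` unit_ball) >]].

Definition op_norm f : R := sup [set `|f x| | x in unit_ball].

Lemma precompactZD (A B : set Y) (a : R) : precompact A -> precompact B ->
  precompact [set a *: u.1 + u.2 | u in A `*` B].
Proof.
rewrite !precompactE => cA cB; rewrite -precompactE.
apply: (@precompact_subset _ _
  ((fun u : Y * Y => a *: u.1 + u.2) @` (closure A `*` closure B))).
  by apply: image_subset => -[u v] [/= Au Bv]; split; exact: subset_closure.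
apply: compact_precompact; first exact: norm_hausdorff.
apply: continuous_compact; last exact: compact_setX.
apply: continuous_subspaceT => u.
apply: cvgD; last exact: cvg_snd.
by apply: cvgZr; exact: cvg_fst.
Qed.

Fact compact_operator_submod_closed : submod_closed compact_operator.
Proof.
split.
  apply/asboolP; split; first by move=> a x y; rewrite /= scaler0 addr0.
  apply: (@precompact_subset _ _ [set 0]); first by move=> _ [x _ <-].
  by apply: compact_precompact; [exact: norm_hausdorff|exact: compact_set1].
move=> a f g /asboolP[lf cf] /asboolP[lg cg]; apply/asboolP; split.
  move=> b x y /=; rewrite -[LHS]/(a *: f (b *: x + y) + g (b *: x + y)).
  rewrite lf lg -[(a *: f + g) x]/(a *: f x + g x).
  rewrite -[(a *: f + g) y]/(a *: f y + g y).
  by rewrite !scalerDr !scalerA [b * a]mulrC addrACA.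
apply: precompact_subset (precompactZD a cf cg) => _ [x xB <-].
by exists (f x, g x) => //; split; exists x.
Qed.

Lemma unit_ball0 : unit_ball 0. Proof. by rewrite /unit_ball/= normr0. Qed.

Lemma compact_operator_ubound f : f \in compact_operator ->
  has_ubound [set `|f x| | x in unit_ball].
Proof.
move=> /asboolP[_]; rewrite precompactE => /compact_bounded.
move=> [M [_ fM]]; exists (M + 1) => _ [x xB <-].
by apply: (fM (M + 1)); rewrite ?ltrDl//; apply: subset_closure; exists x.
Qed.

Lemma ler_op_norm f x : f \in compact_operator -> unit_ball x ->
  `|f x| <= op_norm f.
Proof.
by move=> /compact_operator_ubound ub xB; apply: ub_le_sup => //; exists x.
Qed.

Lemma op_norm_le f (M : R) : (forall x, unit_ball x -> `|f x| <= M) ->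
  op_norm f <= M.
Proof.
move=> fM; apply: ge_sup; first by exists `|f 0|, 0 => //; exact: unit_ball0.
by move=> _ [x xB <-]; exact: fM.
Qed.

End compact_operator.
Arguments unit_ball {R} X.

Record compact_op {R : realType} (X Y : normedModType R) :=
  CompactOp { compact_op_fun :> X -> Y; _ : compact_op_fun \in compact_operator }.

Section compact_op_normed.
Context {R : realType} (X Y : normedModType R).
Local Notation K := (compact_op X Y).

HB.instance Definition _ := [isSub of K for @compact_op_fun R X Y].
HB.instance Definition _ := [Choice of K by <:].
HB.instance Definition _ := GRing.SubChoice_isSubLmodule.Build R _ _ K
  compact_operator_submod_closed.

Fact compact_op_linear (f : K) : linear f.
Proof. by have /asboolP[] := valP f. Qed.

HB.instance Definition _ (f : K) :=
  GRing.isLinear.Build R X Y _ f (compact_op_linear f).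

Fact ler_op_normD (f g : K) : op_norm (f + g) <= op_norm f + op_norm g.
Proof.
apply: op_norm_le => x xB; apply: le_trans (ler_normD _ _) _.
by apply: lerD; apply: ler_op_norm xB; exact: valP.
Qed.

Fact op_normZ a (f : K) : op_norm (a *: f) = `|a| * op_norm f.
Proof.
have le b (g : K) : op_norm (b *: g) <= `|b| * op_norm g.
  apply: op_norm_le => x xB; rewrite [leLHS]normrZ.
  by apply: ler_wpM2l => //; apply: ler_op_norm xB; exact: valP.
have [->|a0] := eqVneq a 0.
  apply/eqP; rewrite eq_le le/= normr0 mul0r.
  exact: le_trans (normr_ge0 _) (ler_op_norm (valP (0 *: f)) unit_ball0).
apply/eqP; rewrite eq_le le/= -ler_pdivlMl ?normr_gt0// -normfV.
by have := le a^-1 (a *: f); rewrite scalerA mulVf// scale1r.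
Qed.

Fact op_norm_eq0 (f : K) : op_norm f = 0 -> f = 0.
Proof.
move=> f0; apply/val_inj/funext => x /=; apply/eqP.
have fB y : unit_ball X y -> f y = 0.
  move=> yB; apply/eqP; rewrite -normr_eq0 eq_le normr_ge0 andbT -f0.
  by apply: ler_op_norm yB; exact: valP.
have [->|x0] := eqVneq x 0; first by rewrite linear0.
have : f (`|x|^-1 *: x) = 0.
  by apply: fB; rewrite /unit_ball/= normrZ normfV normr_id mulVf ?normr_eq0.
by move/eqP; rewrite linearZ/= scaler_eq0 invr_eq0 normr_eq0 (negPf x0).
Qed.

HB.instance Definition _ :=
  Lmodule_isNormed.Build R K ler_op_normD op_normZ op_norm_eq0.

End compact_op_normed.

(* A linear subspace with the restricted norm; not assumed closed. *)
Record lsubspace {R : realType} {Y : normedModType R} (E : submodClosed Y) :=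
  LSubspace { lsubspace_val :> Y; _ : lsubspace_val \in E }.

Section lsubspace_normed.
Context {R : realType} {Y : normedModType R} (E : submodClosed Y).
Local Notation S := (lsubspace E).

HB.instance Definition _ := [isSub of S for @lsubspace_val R Y E].
HB.instance Definition _ := [Choice of S by <:].
HB.instance Definition _ := [SubChoice_isSubLmodule of S by <:].

Fact ler_lsubspace_normD (u v : S) : `|val (u + v)| <= `|val u| + `|val v|.
Proof. by rewrite raddfD; exact: ler_normD. Qed.

Fact lsubspace_normZ a (u : S) : `|val (a *: u)| = `|a| * `|val u|.
Proof. by rewrite linearZ; exact: normrZ. Qed.

Fact lsubspace_norm_eq0 (u : S) : `|val u| = 0 -> u = 0.
Proof. by move=> /normr0_eq0 u0; exact: val_inj. Qed.

HB.instance Definition _ := Lmodule_isNormed.Build R S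
  ler_lsubspace_normD lsubspace_normZ lsubspace_norm_eq0.

End lsubspace_normed.

Definition isomorphic {R : realType} (X Y : normedModType R) : Prop :=
  exists (f : {linear X -> Y}) (g : {linear Y -> X}),
    [/\ cancel f g, cancel g f, continuous f & continuous g].

(* Main.v *)
Require Import Defs.
From HB Require Import structures.
From mathcomp Require Import all_boot all_order all_algebra.
From mathcomp Require Import all_classical all_reals all_analysis.
From mathcomp Require Import ring lra.
Import Order.TTheory GRing.Theory Num.Theory.
Import numFieldNormedType.Exports.
Set Implicit Arguments.
Unset Strict Implicit.
Unset Printing Implicit Defensive.
Local Open Scope classical_set_scope.
Local Open Scope ring_scope.

(** The row [n] of [K(c_0)] spanned by the operators [e n k : x |-> x_k e_n] is
    a copy of [l_1], while a sum of norm-one elements of different rows has norm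
    one.  Let [T] embed [K(c_0)] into [K(c_0(l_p), l_q)].

    (1) Restricted to the first [N] coordinates of [c_0(l_p)], the operators
    [T u], [u] in a row, live in a finite power of [K(l_p, l_q)], which contains
    no [l_1]: by linear algebra there are [l_1]-blocks [u_s] of the row such
    that the matrix of [T u_s] vanishes on the square [[0, m_s)^2] and is
    negligible outside of [[0, m_(s+1))^2].  What is left has disjoint ranges or
    disjoint supports, so that averaging [K] of them yields norm
    [O(K^(1/q-1) + K^(-1/p))].  Hence in every row there is a unit vector [u_n]
    for which [T u_n] is bounded below at some [z_n] supported on coordinates
    beyond any prescribed [N].

    (2) Choosing the [z_n] disjointly, both [u_n] and [z_n] behave like the unit
    vectors of [c_0], and averaging over signs shows that all signed sums of
    the [T u_n z_n] are bounded in [l_q].  As [l_q] contains no [c_0], they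
    cannot be bounded away from [0]. *)

(** * Sequence spaces with coordinate projections *)

(* [E] is where the coordinates live: the scalars for [l_p], and [X] for
   [c_0(X)]. *)
Record seq_space (R : realType) (E X : normedModType R) := SeqSpace {
  ss_coord : nat -> X -> E;
  ss_single : nat -> E -> X;
  ss_mask : pred nat -> X -> X;
  ss_coord_linear : forall n, linear (ss_coord n);
  ss_single_linear : forall n, linear (ss_single n);
  ss_mask_linear : forall P, linear (ss_mask P);
  ss_coord_le : forall n x, `|ss_coord n x| <= `|x|;
  ss_single_le : forall n a, `|ss_single n a| <= `|a|;
  ss_mask_le : forall P x, `|ss_mask P x| <= `|x|;
  ss_maskI : forall P Q x, ss_mask P (ss_mask Q x) = ss_mask (predI P Q) x;
  ss_mask_split : forall P x, x = ss_mask P x + ss_mask (predC P) x;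
  ss_tail : forall x (e : R), 0 < e -> exists m, `|ss_mask (leq m) x| <= e;
  ss_head : forall m x,
    ss_mask (gtn m) x = \sum_(i < m) ss_single i (ss_coord i x) }.

(** One cut of the coordinates into two complementary sets is enough: iterating it gives the formula
    for any finite number of disjoint blocks. *)
Definition lp_like (R : realType) (r : R) (E X : normedModType R)
    (S : seq_space E X) :=
  forall P x,
    `|x| `^ r = `|ss_mask S P x| `^ r + `|ss_mask S (predC P) x| `^ r.

(** Since masks are contractions, this says that the norm is the maximum of the norms of the two
    parts. The form with an upper bound [b] iterates directly. *)
Definition c0_like (R : realType) (E X : normedModType R)
    (S : seq_space E X) :=
  forall P x (b : R), `|ss_mask S P x| <= b -> `|ss_mask S (predC P) x| <= b ->
    `|x| <= b.

Lemma powR_lerP (R : realType) (r a b : R) : 0 < r -> 0 <= a -> 0 <= b ->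
  (a `^ r <= b `^ r) = (a <= b).
Proof.
move=> r0 a0 b0; apply/idP/idP => [|ab]; last first.
  by apply: (ge0_ler_powR (ltW r0)); rewrite ?nnegrE.
apply: contraTT; rewrite -!ltNge => ba.
by apply: (gt0_ltr_powR r0); rewrite ?nnegrE.
Qed.

Lemma powR_ler_inv (R : realType) (r a b : R) : 0 < r -> 0 <= a -> 0 <= b ->
  a `^ r <= b `^ r -> a <= b.
Proof. by move=> r0 a0 b0; rewrite powR_lerP. Qed.

(** * The space [l_r] with its coordinates *)

Section lp_instance.
Context {R : realType} (r : R) (r1 : 1 <= r).
Local Notation l := (lp r1).
Implicit Types (x y : l) (P Q : pred nat).

Let r0 : 0 < r. Proof. exact: lt_le_trans ltr01 r1. Qed.
Let rN0 : r != 0. Proof. by rewrite gt_eqF. Qed.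

Lemma lp_sumE (I : Type) (s : seq I) (F : I -> l) n :
  (\sum_(i <- s) F i) n = \sum_(i <- s) F i n.
Proof. by elim/big_rec2: _ => // i a b _ <-. Qed.

Lemma lp_ext x y : (forall n, x n = y n) -> x = y.
Proof. by move=> xy; apply/val_inj/funext. Qed.

Definition psum x : nat -> R := series (fun n => `|x n| `^ r).

Lemma psum_cvg x : cvgn (psum x).
Proof. by have /asboolP := valP x. Qed.

Lemma lp_normX x : `|x| `^ r = limn (psum x).
Proof.
rewrite -[`|x|]/(lp_norm r x) /lp_norm -powRrM mulVf// powRr1//.
exact: lim_powser_ge0 (valP x).
Qed.

Lemma psum_le_norm x n : psum x n <= `|x| `^ r.
Proof.
rewrite lp_normX; apply: nondecreasing_cvgn_le; last exact: psum_cvg.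
by apply/nondecreasing_series => i _ _; exact: powR_ge0.
Qed.

Lemma lp_coord_le n x : `|x n| <= `|x|.
Proof.
rewrite -(powR_lerP r0)//; apply: le_trans (psum_le_norm x n.+1).
rewrite /psum/series/= big_nat_recr//= lerDr.
by rewrite sumr_ge0// => i _; exact: powR_ge0.
Qed.

Lemma mask_psummable P x :
  (fun n => if P n then x n else 0) \in @psummable R r.
Proof.
apply/asboolP; apply: series_le_cvg (@psum_cvg x) => n; try exact: powR_ge0.
by case: ifP => // _; rewrite normr0 powR0// powR_ge0.
Qed.

Definition lp_mask P x : l := Lp r1 (mask_psummable P x).

Lemma lp_mask_linear P : linear (lp_mask P).
Proof.
move=> a x y; apply: lp_ext => n /=.
rewrite -[RHS]/(a * (lp_mask P x n) + lp_mask P y n) /=.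
by case: ifP; rewrite // mulr0 addr0.
Qed.

Lemma lp_mask_split P x : x = lp_mask P x + lp_mask (predC P) x.
Proof.
apply: lp_ext => n; rewrite -[RHS]/(lp_mask P x n + lp_mask (predC P) x n) /=.
by case: (P n); rewrite ?addr0 ?add0r.
Qed.

Lemma lp_maskI P Q x : lp_mask P (lp_mask Q x) = lp_mask (predI P Q) x.
Proof. by apply: lp_ext => n /=; case: (P n). Qed.

Lemma lp_mask_normX P x :
  `|x| `^ r = `|lp_mask P x| `^ r + `|lp_mask (predC P) x| `^ r.
Proof.
have E : psum x = psum (lp_mask P x) + psum (lp_mask (predC P) x).
  apply/funext => n; rewrite -[RHS]/(psum (lp_mask P x) n + _ n).
  rewrite /psum/series/= -big_split/=; apply: eq_bigr => i _.
  by case: (P i); rewrite normr0 powR0// ?add0r ?addr0.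
apply: etrans (lp_normX x) _; apply: etrans (congr1 (fun s => limn s) E) _.
apply: etrans (limD (@psum_cvg _) (@psum_cvg _)) _.
exact: congr2 (esym (lp_normX _)) (esym (lp_normX _)).
Qed.

Lemma lp_mask_le P x : `|lp_mask P x| <= `|x|.
Proof.
have le_add (a b c : R) : a = b + c -> 0 <= c -> b <= a.
  by move=> -> c0; rewrite lerDl.
apply: (powR_ler_inv r0 (normr_ge0 _) (normr_ge0 _)).
exact: le_add (lp_mask_normX P x) (powR_ge0 _ _).
Qed.

(** The part of [x] below [m] has [r]-th power norm [psum x m], so additivity of the powers leaves
    exactly the remainder of the series for the tail. *)
Lemma lp_tail x (e : R) : 0 < e -> exists m, `|lp_mask (leq m) x| <= e.
Proof.
move=> e0; have e0r : 0 < e `^ r by rewrite powR_gt0.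
have /cvgrPdist_le/(_ _ e0r)[m _ /(_ m (leqnn m))] := @psum_cvg x.
rewrite /= -lp_normX => xm; exists m.
apply: (powR_ler_inv r0 (normr_ge0 _) (ltW e0)).
have hd : `|lp_mask (predC (leq m)) x| `^ r = psum x m.
  rewrite lp_normX; apply: norm_lim_near_cst; exists m => // n /= mn.
  rewrite /psum/series/= (big_cat_nat (n := m))//=.
  rewrite [X in _ + X]big_nat_cond.
  rewrite [X in _ + X]big1 ?addr0 => [|i /andP[/andP[mi _] _]].
    rewrite big_nat_cond [RHS]big_nat_cond; apply: eq_bigr => i.
    by rewrite andbT /= leqNgt => -> .
  by rewrite mi normr0 powR0.
have sub_le (a b c d : R) : a = b + c -> `|a - c| <= d -> b <= d.
  by move=> ->; rewrite addrK; apply: le_trans (ler_norm _).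
by move: xm; rewrite -hd => xm; exact: sub_le (lp_mask_normX (leq m) x) xm.
Qed.

Lemma single_psummable n (a : R) :
  (fun i => if i == n then a else 0) \in @psummable R r.
Proof.
set u := fun i => _; apply/asboolP.
apply: (is_cvg_near_cst (series (fun i => `|u i| `^ r) n.+1)).
exists n.+1 => // m /= nm; rewrite /u.
rewrite /series/= (big_cat_nat (n := n.+1))//=.
rewrite [X in _ + X]big_nat_cond [X in _ + X]big1 ?addr0//.
by move=> i /andP[/andP[ni _] _]; rewrite gtn_eqF// normr0 powR0.
Qed.

Definition lp_single n (a : R^o) : l := Lp r1 (single_psummable n a).

Lemma lp_single_linear n : linear (lp_single n).
Proof.
move=> a b c; apply: lp_ext => i.
rewrite -[RHS]/(a * (lp_single n b i) + lp_single n c i) /=.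
by case: ifP; rewrite // mulr0 addr0.
Qed.

Lemma lp_single_le n (a : R^o) : `|lp_single n a| <= `|a|.
Proof.
rewrite -(powR_lerP r0)// lp_normX.
rewrite (_ : limn _ = `|a| `^ r)//; apply: norm_lim_near_cst.
exists n.+1 => // m /= nm; rewrite /psum/series/= big_mkord.
rewrite (bigD1 (Ordinal nm))//= eqxx big1 ?addr0//.
by move=> j; rewrite -val_eqE/= => /negPf ->; rewrite normr0 powR0.
Qed.

Lemma lp_head m x : lp_mask (gtn m) x = \sum_(i < m) lp_single i (x i).
Proof.
apply: lp_ext => n; rewrite lp_sumE /=; have [nm|nm] := ltnP n m.
  rewrite (bigD1 (Ordinal nm))//= eqxx big1 ?addr0// => i.
  by rewrite -val_eqE/= eq_sym => /negPf ->.
rewrite big1// => i _; rewrite gtn_eqF//.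
exact: leq_trans (ltn_ord i) nm.
Qed.

Definition lp_space : seq_space R^o l :=
  @SeqSpace R R^o l (fun n x => x n : R^o) lp_single lp_mask
    (fun n a x y => erefl) lp_single_linear lp_mask_linear
    lp_coord_le lp_single_le lp_mask_le lp_maskI lp_mask_split lp_tail lp_head.

Lemma lp_space_like : lp_like r lp_space.
Proof. exact: lp_mask_normX. Qed.

End lp_instance.

(** * The space [c_0(X)] with its coordinates *)

Section c0_instance.
Context {R : realType} {X : normedModType R}.
Implicit Types (x y : c0 X) (P Q : pred nat).

Lemma c0_sumE (I : Type) (s : seq I) (F : I -> c0 X) n :
  (\sum_(i <- s) F i) n = \sum_(i <- s) F i n.
Proof. by elim/big_rec2: _ => // i a b _ <-. Qed.

Lemma c0_ext x y : (forall n, x n = y n) -> x = y.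
Proof. by move=> xy; apply/val_inj/funext. Qed.

Lemma c0_coord_le n x : `|x n| <= `|x|.
Proof. exact: ler_sup_norm (valP x). Qed.

Lemma c0_norm_le x (b : R) : (forall n, `|x n| <= b) -> `|x| <= b.
Proof. exact: sup_norm_le. Qed.

Lemma c0_tail_coord x (e : R) : 0 < e ->
  exists m, forall n, (m <= n)%N -> `|x n| <= e.
Proof.
have /asboolP/cvgrPdist_le x0 := valP x; move=> /x0[m _ xm].
by exists m => n /xm; rewrite sub0r normrN normr_id.
Qed.

Lemma null_seq_eventually (u : nat -> X) :
  (forall e : R, 0 < e -> exists m, forall n, (m <= n)%N -> `|u n| <= e) ->
  u \in null_seq.
Proof.
move=> u0; apply/asboolP/cvgrPdist_le => e /u0[m um].
by exists m => // n /um; rewrite sub0r normrN normr_id.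
Qed.

Lemma mask_null_seq P x : (fun n => if P n then x n else 0) \in null_seq.
Proof.
apply: null_seq_eventually => e e0; have [m xm] := c0_tail_coord x e0.
by exists m => n mn; case: ifP => _; [exact: xm|rewrite normr0 ltW].
Qed.

Definition c0_mask P x : c0 X := C0 (mask_null_seq P x).

Lemma c0_mask_linear P : linear (c0_mask P).
Proof.
move=> a x y; apply: c0_ext => n /=.
rewrite -[RHS]/(a *: (c0_mask P x n) + c0_mask P y n) /=.
by case: ifP; rewrite // scaler0 addr0.
Qed.

Lemma c0_mask_split P x : x = c0_mask P x + c0_mask (predC P) x.
Proof.
apply: c0_ext => n; rewrite -[RHS]/(c0_mask P x n + c0_mask (predC P) x n) /=.
by case: (P n); rewrite ?addr0 ?add0r.
Qed.

Lemma c0_maskI P Q x : c0_mask P (c0_mask Q x) = c0_mask (predI P Q) x.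
Proof. by apply: c0_ext => n /=; case: (P n). Qed.

Lemma c0_mask_le P x : `|c0_mask P x| <= `|x|.
Proof.
apply: c0_norm_le => n /=; case: ifP => _; first exact: c0_coord_le.
by rewrite normr0.
Qed.

Lemma c0_mask_max P x (b : R) : `|c0_mask P x| <= b ->
  `|c0_mask (predC P) x| <= b -> `|x| <= b.
Proof.
move=> Pb PCb; apply: c0_norm_le => n.
have := le_trans (c0_coord_le n _) Pb; have := le_trans (c0_coord_le n _) PCb.
by rewrite /=; case: (P n).
Qed.

Lemma c0_tail x (e : R) : 0 < e -> exists m, `|c0_mask (leq m) x| <= e.
Proof.
move=> e0; have [m xm] := c0_tail_coord x e0; exists m.
by apply: c0_norm_le => n /=; case: ifP => [/xm//|_]; rewrite normr0 ltW.
Qed.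

Lemma single_null_seq n (a : X) :
  (fun i => if i == n then a else 0) \in null_seq.
Proof.
apply: null_seq_eventually => e e0; exists n.+1 => i ni.
by rewrite gtn_eqF// normr0 ltW.
Qed.

Definition c0_single n a : c0 X := C0 (single_null_seq n a).

Lemma c0_single_linear n : linear (c0_single n).
Proof.
move=> a b c; apply: c0_ext => i.
rewrite -[RHS]/(a *: (c0_single n b i) + c0_single n c i) /=.
by case: ifP; rewrite // scaler0 addr0.
Qed.

Lemma c0_single_le n a : `|c0_single n a| <= `|a|.
Proof. by apply: c0_norm_le => i /=; case: ifP => // _; rewrite normr0. Qed.

Lemma c0_head m x : c0_mask (gtn m) x = \sum_(i < m) c0_single i (x i).
Proof.
apply: c0_ext => n; rewrite c0_sumE /=; have [nm|nm] := ltnP n m.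
  rewrite (bigD1 (Ordinal nm))//= eqxx big1 ?addr0// => i.
  by rewrite -val_eqE/= eq_sym => /negPf ->.
rewrite big1// => i _; rewrite gtn_eqF//.
exact: leq_trans (ltn_ord i) nm.
Qed.

Definition c0_space : seq_space X (c0 X) :=
  @SeqSpace R X (c0 X) (fun n x => x n) c0_single c0_mask
    (fun n a x y => erefl) c0_single_linear c0_mask_linear
    c0_coord_le c0_single_le c0_mask_le c0_maskI c0_mask_split c0_tail c0_head.

Lemma c0_space_like : c0_like c0_space.
Proof. exact: c0_mask_max. Qed.

End c0_instance.

(** * Estimates on disjoint blocks *)

HB.instance Definition _ (R : realType) (E X : normedModType R)
    (S : seq_space E X) (P : pred nat) :=
  GRing.isLinear.Build R X X _ (ss_mask S P) (ss_mask_linear S P).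
HB.instance Definition _ (R : realType) (E X : normedModType R)
    (S : seq_space E X) (n : nat) :=
  GRing.isLinear.Build R X E _ (ss_coord S n) (ss_coord_linear S n).
HB.instance Definition _ (R : realType) (E X : normedModType R)
    (S : seq_space E X) (n : nat) :=
  GRing.isLinear.Build R E X _ (ss_single S n) (ss_single_linear S n).

Definition block (N : nat -> nat) (s : nat) : pred nat :=
  [pred n | N s <= n < N s.+1]%N.

Lemma predC_leq m : (predC (leq m) : pred nat) = gtn m.
Proof. by apply/funext => n /=; rewrite ltnNge. Qed.

Lemma predC_gtn m : (predC (gtn m) : pred nat) = leq m.
Proof. by apply/funext => n /=; rewrite -leqNgt. Qed.

Section seq_space_theory.
Context {R : realType} {E X : normedModType R} (S : seq_space E X).
Local Notation mask := (ss_mask S).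
Implicit Types (P Q : pred nat) (x z : X).

Lemma mask_split_leq m x : x = mask (gtn m) x + mask (leq m) x.
Proof. by rewrite {1}(ss_mask_split S (gtn m) x) predC_gtn. Qed.

Lemma mask_ext P Q x : P =1 Q -> mask P x = mask Q x.
Proof. by move=> /funext ->. Qed.

(** Splitting [mask predT x] along [predT] reproduces it with [mask pred0 x] as second summand,
    which must therefore vanish. *)
Lemma mask0 x : mask pred0 x = 0.
Proof.
have := ss_mask_split S predT (mask predT x); rewrite !ss_maskI.
rewrite (_ : mask (predI predT predT) x = mask predT x); last exact: mask_ext.
rewrite -{1}[mask predT x]addr0 => /addrI ->; exact: mask_ext.
Qed.

Lemma mask_sub P Q x : subpred P Q -> mask Q (mask P x) = mask P x.
Proof.
move=> PQ; rewrite ss_maskI; apply: mask_ext => n /=.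
by case: (boolP (P n)) => [/PQ ->|]; rewrite ?andbF.
Qed.

Lemma mask_sub_r P Q x : subpred P Q -> mask P (mask Q x) = mask P x.
Proof.
move=> PQ; rewrite ss_maskI; apply: mask_ext => n /=.
by case: (boolP (P n)) => [/PQ ->|].
Qed.

Lemma mask_disjoint P Q x : (forall n, P n -> Q n = false) ->
  mask Q (mask P x) = 0.
Proof.
move=> PQ; rewrite ss_maskI -[RHS](mask0 x); apply: mask_ext => n /=.
by case: (boolP (P n)) => [/PQ ->|]; rewrite ?andbF.
Qed.

Lemma mask_head_le m x : `|mask (gtn m) x| <= \sum_(i < m) `|ss_coord S i x|.
Proof.
rewrite ss_head; apply: le_trans (ler_norm_sum _ _ _) _.
by apply: ler_sum => i _; exact: ss_single_le.
Qed.

Section blocks.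
Variable N : nat -> nat.
Hypothesis N_incr : forall s, (N s <= N s.+1)%N.

Let N_homo s t : (s <= t)%N -> (N s <= N t)%N.
Proof. by move=> st; apply: (homo_leq leqnn leq_trans) => // i. Qed.

Lemma mask_gtn_blocks (z : nat -> X) K :
  (forall s, mask (block N s) (z s) = z s) ->
  mask (gtn (N K)) (\sum_(s < K) z s) = \sum_(s < K) z s.
Proof.
move=> zN; rewrite linear_sum; apply: eq_bigr => s _ /=.
rewrite -zN mask_sub// => n /= /andP[_ ns].
exact: leq_trans ns (N_homo (ltn_ord s)).
Qed.

Lemma mask_leq_blocks (z : nat -> X) K :
  (forall s, mask (block N s) (z s) = z s) ->
  mask (leq (N K)) (\sum_(s < K) z s) = 0.
Proof.
move=> zN; rewrite linear_sum; apply: big1 => s _ /=.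
rewrite -zN mask_disjoint// => n /= /andP[_ ns].
by rewrite leqNgt (leq_trans ns (N_homo (ltn_ord s))).
Qed.

Lemma mask_gtn_block (z : nat -> X) K : mask (block N K) (z K) = z K ->
  mask (gtn (N K)) (z K) = 0.
Proof.
by move=> <-; apply: mask_disjoint => n /= /andP[Kn _]; rewrite ltnNge Kn.
Qed.

Lemma mask_leq_block (z : nat -> X) K : mask (block N K) (z K) = z K ->
  mask (leq (N K)) (z K) = z K.
Proof. by move=> <-; apply: mask_sub => n /= /andP[]. Qed.

(** Induction on [K]: cutting at [N K] separates the earlier summands from [z K], and both parts are
    bounded by [b]. *)
Lemma c0_block_sum (z : nat -> X) (b : R) K : c0_like S -> 0 <= b ->
  (forall s, mask (block N s) (z s) = z s) -> (forall s, `|z s| <= b) ->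
  `|\sum_(s < K) z s| <= b.
Proof.
move=> SS b0 zN zb; elim: K => [|K IH]; first by rewrite big_ord0 normr0.
rewrite big_ord_recr/=; apply: (SS (gtn (N K))); rewrite ?predC_gtn linearD/=.
  by rewrite mask_gtn_blocks// mask_gtn_block// addr0.
by rewrite mask_leq_blocks// mask_leq_block// add0r.
Qed.

Lemma lp_block_sum r (z : nat -> X) K : 0 < r -> lp_like r S ->
  (forall s, mask (block N s) (z s) = z s) ->
  `|\sum_(s < K) z s| `^ r = \sum_(s < K) `|z s| `^ r.
Proof.
move=> r0 SS zN; elim: K => [|K IH].
  by rewrite !big_ord0 normr0 powR0// gt_eqF.
rewrite !big_ord_recr/= (SS (gtn (N K))) predC_gtn !linearD/=.
rewrite mask_gtn_blocks// mask_gtn_block// addr0 IH.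
by rewrite mask_leq_blocks// mask_leq_block// add0r.
Qed.

(** The blocks of [x] add up to a single mask of [x], whose norm is at most that of [x];
    [lp_block_sum] computes its power. *)
Lemma lp_sum_blocks r x K : 0 < r -> lp_like r S ->
  \sum_(s < K) `|mask (block N s) x| `^ r <= `|x| `^ r.
Proof.
move=> r0 SS; rewrite -(lp_block_sum (z := fun s => mask (block N s) x))//.
  rewrite powR_lerP//.
  suff -> : \sum_(s < K) mask (block N s) x =
            mask [pred n | N 0 <= n < N K]%N x by exact: ss_mask_le.
  elim: K => [|K IH].
    rewrite big_ord0 -[LHS](mask0 x); apply: mask_ext => n /=.
    by rewrite ltnNge andbN.
  rewrite big_ord_recr/= IH.
  rewrite [RHS](ss_mask_split S (gtn (N K))) predC_gtn !ss_maskI.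
  congr (_ + _); apply: mask_ext => n /=.
    have := N_incr K; case: (ltnP n (N K)) => nK NK; last by rewrite andbF.
    by rewrite (leq_trans nK NK).
  rewrite /block/=; case: (leqP (N K) n) => //= nK.
  by rewrite (leq_trans (N_homo (leq0n K)) nK).
by move=> s; apply: mask_sub.
Qed.

End blocks.

(** This is [K^(1/r) = o(K)] written without roots. It amounts to [e^(-r) <= K^(r-1)], and [c] is
    the threshold for [K]. *)
Lemma powR_superlinear (r e : R) : 1 < r -> 0 < e ->
  exists K0, forall K, (K0 <= K)%N -> K%:R <= (e * K%:R) `^ r.
Proof.
move=> r1 e0; have r10 : 0 < r - 1 by rewrite subr_gt0.
have r0 : 0 < r by apply: lt_trans r1.
set c := (e `^ r)^-1 `^ (r - 1)^-1.
exists (Num.truncn c).+1 => K cK.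
have {}cK : c <= K%:R.
  by apply: ltW; apply: lt_le_trans (truncnS_gt c) _; rewrite ler_nat.
have er0 : 0 < e `^ r by rewrite powR_gt0.
have K0 : 0 <= K%:R :> R by [].
have : (e `^ r)^-1 <= K%:R `^ (r - 1).
  have -> : (e `^ r)^-1 = c `^ (r - 1).
    by rewrite /c -powRrM mulVf ?gt_eqF// powRr1// invr_ge0 ltW.
  by rewrite powR_lerP// powR_ge0.
rewrite powRM ?(ltW e0)//.
have -> : K%:R `^ r = K%:R * K%:R `^ (r - 1) :> R.
  case: (posnP K) => [->|Kp]; first by rewrite powR0 ?gt_eqF// mul0r.
  rewrite -{2}(powRr1 K0) -powRD; last by rewrite pnatr_eq0 gtn_eqF ?implybT.
  by rewrite addrC subrK.
move=> H; rewrite mulrCA ler_peMr// -ler_pdivrMl// mulr1.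
exact: H.
Qed.

Section lp_blocks.
Variable r : R.
Hypotheses (r1 : 1 < r) (SS : lp_like r S).
Let r0 : 0 < r. Proof. exact: lt_trans r1. Qed.

(** The sum has norm at most [K^(1/r) * b]. The threshold [K0] is fixed before the blocks and the
    vectors, so it can be used to decide how many blocks to build or to average. *)
Lemma lp_block_sum_small (e : R) : 0 < e ->
  exists K0, forall K, (K0 <= K)%N ->
    forall (N : nat -> nat) (z : nat -> X) (b : R),
    (forall s, (N s <= N s.+1)%N) ->
    (forall s, mask (block N s) (z s) = z s) -> (forall s, `|z s| <= b) ->
    `|\sum_(s < K) z s| <= e * K%:R * b.
Proof.
move=> e0; have [K0 HK] := powR_superlinear r1 e0.
exists K0 => K K0K N z b NN zN zb.
have b0 : 0 <= b by apply: le_trans (zb 0%N).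
rewrite -(powR_lerP r0)//; last by rewrite !mulr_ge0// ltW.
rewrite (lp_block_sum (N := N))// powRM//; last by rewrite mulr_ge0// ltW.
apply: (@le_trans _ _ (K%:R * b `^ r)); last first.
  by rewrite ler_wpM2r ?powR_ge0// HK.
rewrite mulr_natl -[X in _ *+ X](card_ord K) -sumr_const.
by apply: ler_sum => s _; rewrite powR_lerP.
Qed.

(** The dual estimate, resting on [K^(1-1/r) = o(K)]. In place of Hölder's inequality, each term is
    bounded by [t <= d + t^r / c], and [lp_sum_blocks] controls the sum of the powers. *)
Lemma lp_sum_blocks_small (e : R) : 0 < e ->
  exists K0, forall K, (K0 <= K)%N ->
    forall (N : nat -> nat) (x : X), (forall s, (N s <= N s.+1)%N) ->
    \sum_(s < K) `|mask (block N s) x| <= e * K%:R * `|x|.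
Proof.
move=> e0; set d := e / 2; have d0 : 0 < d by rewrite divr_gt0.
(* If [t > d], then [t^(r-1) >= c], hence [t <= t^r / c]. The choice of [K] makes [c^-1 <= d * K],
   so that both contributions are at most [d * K], half of the allowed bound. *)
set c := d `^ (r - 1); have c0 : 0 < c by rewrite powR_gt0.
exists (Num.truncn (c^-1 / d)).+1 => K cK N x NN.
have {}cK : c^-1 <= d * K%:R.
  rewrite -ler_pdivrMl// mulrC; apply: ltW.
  by apply: lt_le_trans (truncnS_gt _) _; rewrite ler_nat.
suff H y : `|y| <= 1 -> \sum_(s < K) `|mask (block N s) y| <= e * K%:R.
  have [->|x0] := eqVneq x 0.
    by rewrite normr0 mulr0 big1// => s _; rewrite linear0 normr0.
  have nx : 0 < `|x| by rewrite normr_gt0.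
  have := H (`|x|^-1 *: x); rewrite normrZ normfV normr_id mulVf ?gt_eqF//.
  move=> /(_ (lexx _)) {}H; rewrite -ler_pdivrMr//; apply: le_trans H.
  rewrite mulr_suml ler_sum// => s _.
  by rewrite linearZ normrZ normfV normr_id mulrC.
move=> y1; have step t : 0 <= t -> t <= d + t `^ r / c.
  move=> t0; have [td|td] := leP t d.
    by rewrite ler_wpDr// mulr_ge0 ?powR_ge0// invr_ge0 ltW.
  rewrite ler_wpDl ?(ltW d0)// ler_pdivlMr//.
  have tp : 0 < t by apply: lt_trans td.
  rewrite -[r](subrK 1) powRD ?(gt_eqF tp)//; last by rewrite implybT.
  rewrite (powRr1 t0) mulrC ler_wpM2r// /c powR_lerP ?subr_gt0//.
    exact: ltW.
  exact: ltW.
apply: (@le_trans _ _ (\sum_(s < K) (d + `|mask (block N s) y| `^ r / c))).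
  by apply: ler_sum => s _; exact: step.
rewrite big_split/= sumr_const card_ord -mulr_suml -[d *+ K]mulr_natr.
apply: (@le_trans _ _ (d * K%:R + d * K%:R)); last first.
  by rewrite -mulrDl /d -splitr.
rewrite lerD2l; apply: le_trans cK; rewrite -[leRHS]mul1r ler_wpM2r//.
  by rewrite invr_ge0 ltW.
apply: le_trans (lp_sum_blocks NN y K r0 SS) _.
have <- : 1 `^ r = 1 :> R by rewrite powR1.
by rewrite powR_lerP.
Qed.

End lp_blocks.
End seq_space_theory.

(** * Uniform smallness of tails *)

Lemma mask_leq_mono (R : realType) (E X : normedModType R)
    (S : seq_space E X) x m m' : (m <= m')%N ->
  `|ss_mask S (leq m') x| <= `|ss_mask S (leq m) x|.
Proof.
move=> mm'; rewrite -(@mask_sub_r _ _ _ S (leq m') (leq m)) ?ss_mask_le//.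
by move=> n /=; exact: leq_trans.
Qed.

(** Otherwise a gliding hump yields disjoint blocks [z s] in the unit ball with [g (z s) >= e / 2].
    The value of [g] at the sum of [K] of them grows linearly in [K], while the norm of that sum is
    [o(K)] because [1 < r]. *)
Lemma functional_tail (R : realType) (E X : normedModType R)
    (S : seq_space E X) (r C : R) (g : {linear X -> R^o}) :
  1 < r -> lp_like r S -> (forall x, `|g x| <= C * `|x|) ->
  forall e : R, 0 < e -> exists m, forall x,
    `|g (ss_mask S (leq m) x)| <= e * `|x|.
Proof.
move=> r1 SS gC e e0; apply: contrapT => /forallNP bad.
have C1 : 0 < `|C| + 1 by rewrite ltr_wpDl.
have {}gC x : `|g x| <= (`|C| + 1) * `|x|.
  apply: le_trans (gC x) _; rewrite ler_wpM2r//.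
  by apply: le_trans (ler_norm C) _; rewrite lerDl.
have hump m : exists mz : nat * X, [/\ (m <= mz.1)%N, `|mz.2| <= 1,
    ss_mask S [pred n | m <= n < mz.1]%N mz.2 = mz.2 & e / 2 <= g mz.2].
  have [x] := (existsNP _).2 (bad m); move=> /negP; rewrite -ltNge => gx.
  have x0 : 0 < `|x|.
    rewrite lt_neqAle normr_ge0 andbT eq_sym; apply/eqP => x0.
    move: gx; rewrite (normr0_eq0 x0) !linear0 !normr0 mulr0 ltxx//.
  set y := `|x|^-1 *: ss_mask S (leq m) x.
  have ym : ss_mask S (leq m) y = y by rewrite linearZ/= mask_sub.
  have y1 : `|y| <= 1.
    rewrite normrZ normfV normr_id mulrC ler_pdivrMr// mul1r.
    exact: ss_mask_le.
  have gy : e < `|g y|.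
    by rewrite linearZ/= normrM normfV normr_id mulrC ltr_pdivlMr.
  have t0 : 0 < e / 2 / (`|C| + 1) by rewrite !divr_gt0.
  have [m' ym'] := ss_tail S y t0.
  set z := ss_mask S (gtn (maxn m m')) y.
  have z1 : `|z| <= 1 by apply: le_trans (ss_mask_le _ _ _) y1.
  have zm : ss_mask S [pred n | m <= n < maxn m m']%N z = z.
    rewrite /z -ym !ss_maskI; apply: mask_ext => n /=.
    by case: (m <= n)%N; case: (n < maxn m m')%N.
  have gz : e / 2 <= `|g z|.
    have yz : y = z + ss_mask S (leq (maxn m m')) y by exact: mask_split_leq.
    have : `|g (ss_mask S (leq (maxn m m')) y)| <= e / 2.
      apply: le_trans (gC _) _; rewrite mulrC -ler_pdivlMr//.
      exact: le_trans (mask_leq_mono S y (leq_maxr m m')) ym'.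
    move: gy; rewrite {1}yz linearD.
    have := ler_normD (g z) (g (ss_mask S (leq (maxn m m')) y)).
    by lra.
  (* The sign makes the value of [g] positive, so that the values at different humps add up without
     cancellation. *)
  exists (maxn m m', Num.sg (g z) *: z); split => /=.
  - exact: leq_maxl.
  - rewrite normrZ; apply: le_trans z1; rewrite ler_piMl// normr_sg.
    by case: (_ == _).
  - by rewrite linearZ/= zm.
  - by rewrite linearZ/= -[_ *: _]/(Num.sg (g z) * g z) -normrEsg.
have /choice[F HF] := hump.
pose N := fix N s := if s is s'.+1 then (F (N s')).1 else 0%N.
pose z s := (F (N s)).2.
have NN s : (N s <= N s.+1)%N by have [] := HF (N s).
(* This tolerance bounds [g] at the sum by [K * e / 4], against the lower bound [K * e / 2]; [K] is
   taken at least 1 to make the contradiction strict. *)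
have t0 : 0 < e / 4 / (`|C| + 1) by rewrite !divr_gt0.
have [K0 HK] := lp_block_sum_small r1 SS t0.
have := HK (maxn K0 1) (leq_maxl _ _) N z 1 NN.
set K := maxn K0 1.
move=> /(_ (fun s => let: And4 _ _ h _ := HF (N s) in h)).
move=> /(_ (fun s => let: And4 _ h _ _ := HF (N s) in h)) zK.
have : K%:R * (e / 2) <= `|g (\sum_(s < K) z s)|.
  apply: le_trans (ler_norm _); rewrite linear_sum mulr_natl.
  rewrite -[X in _ *+ X](card_ord K) -sumr_const.
  by apply: ler_sum => s _; have [] := HF (N s).
apply/negP; rewrite -ltNge; apply: le_lt_trans (gC _) _.
rewrite mulrC -ltr_pdivlMr//; apply: le_lt_trans zK _.
rewrite mulr1 ltr_pdivlMr// mulrAC mulfVK ?gt_eqF//.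
have : 0 < K%:R :> R by rewrite ltr0n /K leq_max orbT.
by nra.
Qed.

(** Finitely many balls of radius [e / 2] cover the closure of [A]; the largest of the tail indices
    of their centres serves for all of [A]. *)
Lemma precompact_tail (R : realType) (E Y : normedModType R)
    (S : seq_space E Y) (A : set Y) (e : R) : precompact A -> 0 < e ->
  exists m, forall y, A y -> `|ss_mask S (leq m) y| <= e.
Proof.
rewrite precompactE compact_cover => cA e0.
have e20 : 0 < e / 2 by rewrite divr_gt0.
have /choice[M HM] : forall y, exists m, `|ss_mask S (leq m) y| <= e / 2.
  by move=> y; exact: ss_tail.
have [y _|y _|D _ AD] := cA Y setT (fun y => ball y (e / 2)).
- exact: ball_open.
- by exists y => //=; exact: ballxx.
exists (\max_(y <- finmap.enum_fset D) M y)%N => y Ay.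
have [x xD] := AD y (subset_closure Ay).
rewrite -ball_normE/= => xy.
rewrite -(subrK x y) linearD/= [leRHS]splitr.
apply: le_trans (ler_normD _ _) _; apply: lerD.
  by apply: le_trans (ss_mask_le _ _ _) _; rewrite distrC ltW.
apply: le_trans (HM x); apply: mask_leq_mono; exact: leq_bigmax_seq.
Qed.

Lemma linear_le_of_unit_ball (R : realType) (X Y : normedModType R)
    (f : {linear X -> Y}) (b : R) :
  (forall x, `|x| <= 1 -> `|f x| <= b) -> forall x, `|f x| <= b * `|x|.
Proof.
move=> fb x; have [->|x0] := eqVneq x 0; first by rewrite linear0 !normr0 mulr0.
have nx : 0 < `|x| by rewrite normr_gt0.
have := fb (`|x|^-1 *: x); rewrite linearZ !normrZ normfV normr_id.
by rewrite mulVf ?gt_eqF// lexx ler_pdivrMl// mulrC; apply.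
Qed.

Lemma compact_op_le (R : realType) (X Y : normedModType R)
    (A : compact_op X Y) x : `|A x| <= `|A| * `|x|.
Proof.
by apply: linear_le_of_unit_ball => y y1; exact: ler_op_norm (valP A) _.
Qed.

(** The tail of the range is small by precompactness of the image of the unit ball. For the tail of
    the domain, only the first [m1] output coordinates then matter, and each is a bounded functional
    to which [functional_tail] applies. *)
Lemma compact_tails (R : realType) (E X Y : normedModType R)
    (SX : seq_space E X) (SY : seq_space R^o Y) (r : R)
    (A : compact_op X Y) (e : R) :
  1 < r -> lp_like r SX -> 0 < e ->
  exists m, forall x, `|ss_mask SY (leq m) (A x)| <= e * `|x| /\
                      `|A (ss_mask SX (leq m) x)| <= e * `|x|.
Proof.
move=> r1 SS e0; have e20 : 0 < e / 2 by rewrite divr_gt0.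
have /asboolP[_ cA] := valP A.
have rowtail d : 0 < d ->
    exists m, forall x, `|ss_mask SY (leq m) (A x)| <= d * `|x|.
  move=> d0; have [m Hm] := precompact_tail SY cA d0; exists m => x.
  apply: (linear_le_of_unit_ball (f := ss_mask SY (leq m) \o A)) => y y1.
  by apply: Hm; exists y.
have [m1 Hm1] := rowtail _ e20.
(* The [m1] coordinates together contribute at most [e / 2]; the successor keeps the denominator
   nonzero. *)
have d0 : 0 < e / 2 / m1.+1%:R by rewrite divr_gt0.
have /choice[F HF] : forall i : nat, exists m, forall x,
    `|ss_coord SY i (A (ss_mask SX (leq m) x))| <= e / 2 / m1.+1%:R * `|x|.
  move=> i.
  apply: (functional_tail (g := ss_coord SY i \o A) (C := `|A|) r1 SS) => // x.
  by apply: le_trans (ss_coord_le _ _ _) (compact_op_le A x).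
pose m2 := (\max_(i < m1) F i)%N.
exists (maxn m1 m2) => x; split.
  apply: le_trans (mask_leq_mono _ _ (leq_maxl _ _)) _.
  apply: le_trans (Hm1 x) _; rewrite ler_wpM2r// ler_pdivrMr//.
  by rewrite ler_peMr ?(ltW e0)// ler1n.
set x' := ss_mask SX _ x; have x'x : `|x'| <= `|x| by exact: ss_mask_le.
rewrite (mask_split_leq SY m1 (A x')) (splitr e) mulrDl.
apply: le_trans (ler_normD _ _) _; apply: lerD; last first.
  by apply: le_trans (Hm1 x') _; rewrite ler_wpM2l// ltW.
apply: le_trans (mask_head_le _ _ _) _.
apply: (@le_trans _ _ (\sum_(i < m1) e / 2 / m1.+1%:R * `|x|)).
  apply: ler_sum => i _; apply: (le_trans _ (ler_wpM2l (ltW d0) x'x)).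
  have := HF i x'; rewrite {1}/x' mask_sub// => n /=; apply: leq_trans.
  apply: leq_trans (leq_maxr _ _); exact: leq_bigmax.
rewrite sumr_const card_ord -mulrnAl ler_wpM2r// -mulr_natr -mulrA.
by rewrite ler_piMr ?(ltW e20)// ler_pdivrMl// mulr1 ler_nat.
Qed.

(** * No copy of [l_1] in [K(l_p, l_q)] *)

Lemma sum_support (V : zmodType) (f : nat -> V) (k d D : nat) :
  (k + d <= D)%N -> (forall i, ~~ (k <= i < k + d)%N -> f i = 0) ->
  \sum_(i < D) f i = \sum_(i < d) f (k + i)%N.
Proof.
move=> kD f0; rewrite -(big_mkord xpredT).
rewrite (big_cat_nat (leq0n k) (leq_trans (leq_addr d k) kD))/=.
rewrite [X in X + _]big_nat_cond [X in X + _]big1 ?add0r => [|i /andP[ik _]].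
  rewrite (big_cat_nat (leq_addr d k) kD)/=.
  rewrite [X in _ + X]big_nat_cond [X in _ + X]big1 ?addr0 => [|i].
    rewrite -{1}[k]add0n big_addn addKn big_mkord.
    by under eq_bigr do rewrite addnC.
  by move=> /andP[/andP[ki _] _]; apply: f0; rewrite [(i < _)%N]ltnNge ki andbF.
by apply: f0; move: ik => /= ik; rewrite leqNgt ik.
Qed.

(** Any [#|I| + 1] vectors with [#|I|] entries are linearly dependent. The relation among those of
    index [k] to [k + #|I|] is scaled to [l_1]-norm one and extended by zero. The sums run to any
    [D >= k1], so that several relations can later be written with a common length. *)
Lemma kernel_combination (R : realFieldType) (I : finType) (F : nat -> I -> R)
    (k : nat) :
  exists (a : nat -> R) (k1 : nat),
    [/\ forall i, ~~ (k <= i < k1)%N -> a i = 0,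
        forall D, (k1 <= D)%N -> \sum_(i < D) `|a i| = 1 &
        forall D c, (k1 <= D)%N -> \sum_(i < D) a i * F i c = 0].
Proof.
set d := #|I|; pose A := \matrix_(i < d.+1, c < d) F (k + i)%N (enum_val c).
have : kermx A != 0.
  rewrite kermx_eq0 -row_leq_rank -ltnNge; apply: leq_ltn_trans (ltnSn d).
  exact: rank_leq_col.
move=> /rowV0Pn[v /sub_kermxP vA v0].
pose t := \sum_(i < d.+1) `|v 0 i|.
have t0 : 0 < t.
  rewrite lt_neqAle sumr_ge0 ?andbT// eq_sym; apply: contraNneq v0 => t0.
  apply/eqP/rowP => i; rewrite mxE; apply/eqP; rewrite -normr_eq0.
  by move: t0 => /psumr_eq0P ->.
pose a i := if (k <= i < k + d.+1)%N then v 0 (inord (i - k)) / t else 0.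
have aE (i : 'I_d.+1) : a (k + i)%N = v 0 i / t.
  by rewrite /a leq_addr ltn_add2l ltn_ord/= addKn inord_val.
have a0 i : ~~ (k <= i < k + d.+1)%N -> a i = 0 by rewrite /a => /negPf ->.
exists a, (k + d.+1)%N; split => // [D kD|D c kD].
  rewrite (sum_support (f := fun i => `|a i|) kD) => [|i /a0 ->]; last first.
    by rewrite normr0.
  under eq_bigr do rewrite aE normrM normfV (gtr0_norm t0).
  by rewrite -mulr_suml divff// gt_eqF.
rewrite (sum_support (f := fun i => a i * F i c) kD) => [|i /a0 ->]; last first.
  by rewrite mul0r.
under eq_bigr do rewrite aE mulrAC.
rewrite -mulr_suml (_ : \sum_(i < _) _ = (v *m A) 0 (enum_rank c)).
  by rewrite vA mxE mul0r.
by rewrite mxE; apply: eq_bigr => i _; rewrite mxE enum_rankK.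
Qed.

Lemma compact_op_sumE (R : realType) (X Y : normedModType R) (I : Type)
    (s : seq I) (P : pred I) (F : I -> compact_op X Y) x :
  (\sum_(i <- s | P i) F i) x = \sum_(i <- s | P i) F i x.
Proof. by elim/big_rec2: _ => // i a b _ <-. Qed.

Lemma compact_op_scaleE (R : realType) (X Y : normedModType R) (a : R)
    (A : compact_op X Y) x : (a *: A) x = a *: A x.
Proof. by []. Qed.

Section small_combination.
Context {R : realType} {X Y : normedModType R}.
Variables (SX : seq_space R^o X) (SY : seq_space R^o Y) (p q : R).
Hypotheses (p1 : 1 < p) (q1 : 1 < q) (SXp : lp_like p SX) (SYq : lp_like q SY).
Variables (n : nat) (B : nat -> 'I_n -> compact_op X Y) (M : R).
Hypothesis BM : forall k j x, `|B k j x| <= M * `|x|.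
Local Notation maskX := (ss_mask SX).
Local Notation maskY := (ss_mask SY).

(** One step of the gliding hump: [kernel_combination] annihilates the [m]-square of all [n]
    operators with the same coefficients, and [compact_tails] provides the end [m1] of the new
    block. *)
Lemma compressed_step (k m : nat) (e : R) : 0 < e ->
  exists (a : nat -> R) (k1 m1 : nat) (A : 'I_n -> compact_op X Y),
    [/\ forall i, ~~ (k <= i < k1)%N -> a i = 0,
        forall D, (k1 <= D)%N -> \sum_(i < D) `|a i| = 1,
        forall D j, (k1 <= D)%N -> \sum_(i < D) a i *: B i j = A j,
        (m <= m1)%N &
        forall j x, [/\ maskY (gtn m) (A j (maskX (gtn m) x)) = 0,
          `|maskY (leq m1) (A j x)| <= e * `|x| &
          `|A j (maskX (leq m1) x)| <= e * `|x|]].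
Proof.
move=> e0.
(* The index [c] consists of the operator, the column and the row of a matrix entry. *)
pose F i (c : 'I_n * 'I_m * 'I_m) : R :=
  ss_coord SY c.2 (B i c.1.1 (ss_single SX c.1.2 (1 : R^o))).
have [a [k1 [ak a1 aF]]] := kernel_combination F k.
pose A j := \sum_(i < k1) a i *: B i j.
have /choice[g Hg] :=
  fun j => @compact_tails _ _ _ _ SX SY _ (A j) _ p1 SXp e0.
exists a, k1, (maxn m (\max_(j < n) g j)), A; split => //.
- move=> D j kD; rewrite /A -!(big_mkord xpredT (fun i => a i *: B i j)).
  rewrite (big_cat_nat (leq0n k1) kD)/=.
  rewrite [X in _ + X]big_nat_cond [X in _ + X]big1 ?addr0// => i.
  move=> /andP[/andP[ki _] _]; rewrite ak ?scale0r//.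
  by rewrite [(i < _)%N]ltnNge ki andbF.
- exact: leq_maxl.
move=> j x; split; last 2 first.
- apply: le_trans (proj1 (Hg j x)); apply: mask_leq_mono.
  by apply: leq_trans (leq_maxr _ _); exact: leq_bigmax.
- have jm : (g j <= maxn m (\max_(j < n) g j))%N.
    by apply: leq_trans (leq_maxr _ _); exact: leq_bigmax.
  rewrite -(@mask_sub _ _ _ SX (leq (maxn m (\max_(j < n) g j))) (leq (g j))).
    apply: le_trans (proj2 (Hg j _)) _.
    by rewrite ler_wpM2l ?(ltW e0)// ss_mask_le.
  by move=> i /=; exact: leq_trans.
rewrite [X in A j X]ss_head linear_sum/= linear_sum/= big1// => i _.
have -> : ss_coord SX i x = ss_coord SX i x *: (1 : R^o).
  by rewrite -[RHS]/(ss_coord SX i x * 1) mulr1.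
rewrite !linearZ/= ss_head big1 ?scaler0// => l _.
rewrite [X in ss_single SY l X](_ : _ = 0) ?linear0//.
rewrite /A compact_op_sumE linear_sum -[RHS](aF k1 (j, i, l) (leqnn _)).
by apply: eq_bigr => s _; rewrite compact_op_scaleE linearZ.
Qed.

(** The combination is the average of [K] successive outputs of [compressed_step]. Each output is,
    up to small tails, a part with range in its own block plus a part depending only on its own
    block of [x]; the exponents [q] and [p] make the averages of the two kinds small. *)
Lemma small_combination (e : R) : 0 < e ->
  exists (D : nat) (a : nat -> R), \sum_(k < D) `|a k| = 1 /\
    forall j x, `|(\sum_(k < D) a k *: B k j) x| <= e * `|x|.
Proof.
move=> e0.
have M1 : 0 < `|M| + 1 by rewrite ltr_wpDl.
set M' := `|M| + 1.
have BM' k j x : `|B k j x| <= M' * `|x|.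
  apply: le_trans (BM k j x) _; rewrite ler_wpM2r//.
  by apply: le_trans (ler_norm M) _; rewrite lerDl.
(* Four errors are allowed [d] each: the disjoint ranges, the two tails and the disjoint supports.
   The first and the last carry a factor [M'], hence the tolerance [d / M']. *)
set d := e / 4; have d0 : 0 < d by rewrite divr_gt0.
have dM : 0 < d / M' by rewrite divr_gt0.
have [K1 HK1] := lp_block_sum_small q1 SYq dM.
have [K2 HK2] := lp_sum_blocks_small p1 SXp dM.
set K := maxn 1 (maxn K1 K2).
have K1K : (K1 <= K)%N by rewrite !leq_max leqnn !orbT.
have K2K : (K2 <= K)%N by rewrite !leq_max leqnn !orbT.
have K0 : 0 < K%:R :> R by rewrite ltr0n leq_max.
have step (km : nat * nat) :
    exists u : (nat -> R) * (nat * nat) * ('I_n -> compact_op X Y),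
    let a := u.1.1 in let k1 := u.1.2.1 in let m1 := u.1.2.2 in let A := u.2 in
    [/\ forall i, ~~ (km.1 <= i < k1)%N -> a i = 0,
        forall D, (k1 <= D)%N -> \sum_(i < D) `|a i| = 1,
        forall D j, (k1 <= D)%N -> \sum_(i < D) a i *: B i j = A j,
        (km.2 <= m1)%N &
        forall j x, [/\ maskY (gtn km.2) (A j (maskX (gtn km.2) x)) = 0,
          `|maskY (leq m1) (A j x)| <= d * `|x| &
          `|A j (maskX (leq m1) x)| <= d * `|x|]].
  have [a [k1 [m1 [A H]]]] := compressed_step km.1 km.2 d0.
  by exists (a, (k1, m1), A).
have /choice[f Hf] := step.
pose km := fix km s := if s is s'.+1 then (f (km s')).1.2 else (0, 0)%N.
pose N s := (km s).2; pose k s := (km s).1.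
pose a s := (f (km s)).1.1; pose A s := (f (km s)).2.
have NN s : (N s <= N s.+1)%N by have [] := Hf (km s).
have a0 s i : ~~ (k s <= i < k s.+1)%N -> a s i = 0.
  by have [+ _ _ _ _] := Hf (km s); apply.
have a1 s D : (k s.+1 <= D)%N -> \sum_(i < D) `|a s i| = 1.
  by have [_ + _ _ _] := Hf (km s); apply.
have aB s D j : (k s.+1 <= D)%N -> \sum_(i < D) a s i *: B i j = A s j.
  by have [_ _ + _ _] := Hf (km s); apply.
have AN s j x : maskY (gtn (N s)) (A s j (maskX (gtn (N s)) x)) = 0.
  by have [_ _ _ _ /(_ j x)[]] := Hf (km s).
have AY s j x : `|maskY (leq (N s.+1)) (A s j x)| <= d * `|x|.
  by have [_ _ _ _ /(_ j x)[]] := Hf (km s).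
have AX s j x : `|A s j (maskX (leq (N s.+1)) x)| <= d * `|x|.
  by have [_ _ _ _ /(_ j x)[]] := Hf (km s).
(* A reversed window would force all the coefficients [a s] to vanish, against their [l_1]-norm
   one. *)
have kk s : (k s <= k s.+1)%N.
  rewrite leqNgt; apply/negP => ks; have := a1 s _ (leqnn _).
  rewrite big1 => [/eqP|i _]; first by rewrite eq_sym oner_eq0.
  rewrite a0 ?normr0//; apply/negP => /andP[ki _].
  by have := ltn_trans (leq_ltn_trans ki (ltn_ord i)) ks; rewrite ltnn.
have kh s t : (s <= t)%N -> (k s <= k t)%N.
  by move=> st; apply: (homo_leq leqnn leq_trans) => // i.
have AM s j x : `|A s j x| <= M' * `|x|.
  rewrite -(aB s _ j (leqnn _)) compact_op_sumE.
  apply: le_trans (ler_norm_sum _ _ _) _.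
  rewrite -[X in X * `|x|]mul1r -(a1 s _ (leqnn _)) -mulrA mulr_suml.
  apply: ler_sum => i _; rewrite compact_op_scaleE normrZ.
  by rewrite ler_wpM2l ?BM'.
(* The [a s] have disjoint supports, so the absolute values add up and the average keeps [l_1]-norm
   one. *)
exists (k K), (fun i => K%:R^-1 * \sum_(s < K) a s i); split.
  have abs_sum L i : `|\sum_(s < L) a s i| = \sum_(s < L) `|a s i|.
    elim: L => [|L IH]; first by rewrite !big_ord0 normr0.
    rewrite !big_ord_recr/= -IH; have [ki|ik] := leqP (k L) i.
      rewrite big1 ?normr0 ?add0r// => s _; apply: a0.
      by rewrite [(i < _)%N]ltnNge (leq_trans (kh _ _ (ltn_ord s)) ki) andbF.
    by rewrite [a L i]a0 ?normr0 ?addr0// leqNgt ik.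
  under eq_bigr do rewrite normrM normfV normr_nat abs_sum.
  rewrite -mulr_sumr exchange_big/=.
  under eq_bigr => s _ do rewrite a1 ?kh//.
  by rewrite sumr_const card_ord mulVf// gt_eqF.
move=> j x.
have -> : \sum_(i < k K) (K%:R^-1 * \sum_(s < K) a s i) *: B i j =
    K%:R^-1 *: \sum_(s < K) A s j.
  under eq_bigr do rewrite -scalerA scaler_suml.
  rewrite -scaler_sumr exchange_big/=; congr (_ *: _).
  by apply: eq_bigr => s _; rewrite aB// kh.
rewrite compact_op_scaleE normrZ.
rewrite normfV normr_nat ler_pdivrMl// compact_op_sumE.
(* The part with range in the block [s]; these ranges are disjoint, which is where [q] enters. *)
pose z s := maskY (block N s) (A s j (maskX (gtn (N s.+1)) x)).
have zM s : `|z s| <= M' * `|x|.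
  apply: le_trans (ss_mask_le _ _ _) _; apply: le_trans (AM _ _ _) _.
  by rewrite ler_wpM2l ?(ltW M1)// ss_mask_le.
have zN s : maskY (block N s) (z s) = z s by exact: mask_sub.
(* Up to the two tails, [A] minus its part with range in the block is
   [maskY (gtn m) \o A \o maskX block], since [A] vanishes on the [m]-square. *)
have diff s : `|A s j x - z s| <=
    d * `|x| + d * `|x| + M' * `|maskX (block N s) x|.
  set x' := maskX (gtn (N s.+1)) x.
  have e1 : A s j x = A s j x' + A s j (maskX (leq (N s.+1)) x).
    by rewrite -linearD -mask_split_leq.
  have e2 : A s j x' = z s + maskY (gtn (N s)) (A s j (maskX (block N s) x)) +
      maskY (leq (N s.+1)) (A s j x').
    rewrite {1}(mask_split_leq SY (N s.+1) (A s j x')); congr (_ + _).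
    rewrite {1}(ss_mask_split SY (leq (N s)) (maskY _ _)) predC_leq !ss_maskI.
    congr (_ + _).
    transitivity (maskY (gtn (N s)) (A s j x')).
      apply: mask_ext => i /=; case: (ltnP i (N s)) => //= iN.
      by rewrite (leq_trans iN (NN s)).
    rewrite {1}(mask_split_leq SX (N s) x') linearD/= linearD/=.
    by rewrite AN add0r /x' ss_maskI.
  rewrite e1 [X in X + _ - _]e2.
  set u1 := A s j (maskX (leq _) x); set u2 := maskY (leq _) _.
  set u3 := maskY (gtn _) _.
  have -> : z s + u3 + u2 + u1 = u1 + u2 + u3 + z s.
    by rewrite -2!addrA addrC [u3 + _]addrC [u2 + u1]addrC.
  rewrite addrK.
  apply: le_trans (ler_normD _ _) _; apply: lerD; last first.
    by apply: le_trans (ss_mask_le _ _ _) _; exact: AM.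
  apply: le_trans (ler_normD _ _) _; apply: lerD; first exact: AX.
  apply: le_trans (AY _ _ _) _.
  by rewrite ler_wpM2l ?(ltW d0)// ss_mask_le.
have -> : \sum_(s < K) A s j x =
    \sum_(s < K) z s + \sum_(s < K) (A s j x - z s).
  by rewrite -big_split/=; apply: eq_bigr => s _; rewrite addrC subrK.
have h1 := HK1 K K1K N z (M' * `|x|) NN zN zM.
have h2 := HK2 K K2K N x NN.
have h3 : `|\sum_(s < K) (A s j x - z s)| <=
    (d * `|x| + d * `|x|) *+ K + M' * \sum_(s < K) `|maskX (block N s) x|.
  rewrite mulr_sumr -[X in _ *+ X](card_ord K) -sumr_const -big_split/=.
  apply: le_trans (ler_norm_sum _ _ _) _.
  by apply: ler_sum => s _; exact: diff.
have h4 : d / M' * K%:R * (M' * `|x|) = d * K%:R * `|x|.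
  by rewrite mulrA; congr (_ * _); rewrite mulrAC divfK// gt_eqF.
have h5 : M' * \sum_(s < K) `|maskX (block N s) x| <= d * K%:R * `|x|.
  rewrite -h4 [leRHS]mulrCA [leRHS]mulrA -[leRHS]mulrA ler_wpM2l// ltW//.
apply: le_trans (ler_normD _ _) _.
have -> : K%:R * (e * `|x|) =
    d * K%:R * `|x| + ((d * `|x| + d * `|x|) *+ K + d * K%:R * `|x|).
  rewrite -mulr_natl [in LHS](_ : e = d *+ 4); last first.
    by rewrite /d -mulr_natr divfK// pnatr_eq0.
  by ring.
apply: lerD; first by rewrite -h4.
by apply: le_trans h3 _; rewrite lerD2l.
Qed.

End small_combination.

(** * No copy of [c_0] in [l_q] *)

(* Averaging over equal signs [th = tau] kills the off-diagonal terms
   [S_s (x_i)], [s <> i]; the extra vector [w] makes the induction work. *)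
Lemma diagonal_sum_le (R : realType) (X : lmodType R) (Y : normedModType R)
    (S : nat -> {linear X -> Y}) (x : nat -> X) (M : R) (K : nat) (w : Y) :
  (forall th tau : nat -> bool,
    `|\sum_(s < K) (-1) ^+ th s *: S s (\sum_(i < K) (-1) ^+ tau i *: x i) + w|
      <= M) ->
  `|\sum_(s < K) S s (x s) + w| <= M.
Proof.
elim: K w => [|K IH] w H.
  by have := H xpredT xpredT; rewrite !big_ord0.
rewrite big_ord_recr/= -addrA; apply: IH => th tau.
pose ext (b : bool) (f : nat -> bool) i := if i == K then b else f i.
have extE b f (i : 'I_K) : ext b f i = f i by rewrite /ext ltn_eqF.
have extK b f : ext b f K = b by rewrite /ext eqxx.
have sumE b (f : nat -> bool) (g : nat -> X) :
    \sum_(i < K.+1) (-1) ^+ ext b f i *: g i =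
    \sum_(i < K) (-1) ^+ f i *: g i + (-1) ^+ b *: g K :> X.
  by rewrite big_ord_recr/= extK; under eq_bigr do rewrite extE.
set v := \sum_(i < K) (-1) ^+ tau i *: x i.
set A := fun y => \sum_(s < K) (-1) ^+ th s *: S s y.
have AD y z : A (y + z) = A y + A z.
  by rewrite /A -big_split; apply: eq_bigr => s _; rewrite linearD scalerDr.
have AN y : A (- y) = - A y.
  by rewrite /A -sumrN; apply: eq_bigr => s _; rewrite linearN scalerN.
have SE b y : \sum_(s < K.+1) (-1) ^+ ext b th s *: S s y =
    A y + (-1) ^+ b *: S K y.
  by rewrite big_ord_recr/= extK; under eq_bigr do rewrite extE.
have := H (ext false th) (ext false tau).
have := H (ext true th) (ext true tau).
rewrite !sumE !SE -/v !expr0 !expr1 !scale1r !scaleN1r.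
rewrite !(linearD (S K)) !AD (linearN (S K)) AN.
set a := A v; set b := A (x K); set c := S K v; set d := S K (x K) => h1 h2.
have -> : a + (d + w) = 2^-1 *: ((a - b - (c - d) + w) + (a + b + (c + d) + w)).
  apply: (scalerI (a := 2)); first by rewrite pnatr_eq0.
  rewrite scalerA divff ?pnatr_eq0// scale1r scaler_nat mulr2n.
  rewrite opprB [RHS]addrACA.
  rewrite [in RHS](addrACA (a - b)) [a - b + _]addrACA addNr addr0.
  by rewrite [d - c + _]addrA subrK [LHS]addrACA [d + w + _]addrACA [LHS]addrA.
rewrite normrZ ger0_norm ?invr_ge0// ler_pdivrMl//.
apply: le_trans (ler_normD _ _) _.
by rewrite mulr_natl mulr2n lerD.
Qed.

Section no_c0.
Context {R : realType} {Y : normedModType R}.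
Variables (SY : seq_space R^o Y) (q : R).
Hypotheses (q0 : 0 < q) (SYq : lp_like q SY).

(** Bounded signed sums make each coordinate of [y] absolutely summable, so some subsequence has
    blocks [z s] of norm at least [c / 2] on disjoint sets. By [diagonal_sum_le] the sums of the
    [z s] stay bounded by [M], whereas the [q]-th power of their norm grows at least linearly. *)
Lemma no_unconditional_bounded (y : nat -> Y) (M c : R) : 0 < c ->
  (forall n, c <= `|y n|) ->
  (forall (nu : nat -> nat) (K : nat) (tau : nat -> bool),
    (forall s, (nu s < nu s.+1)%N) ->
    `|\sum_(s < K) (-1) ^+ tau s *: y (nu s)| <= M) -> False.
Proof.
move=> c0 yc yM.
have M0 : 0 <= M by apply: le_trans (yM id 0%N xpredT _).
have coordM i K : \sum_(s < K) `|ss_coord SY i (y s)| <= M.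
  (* The signs are those of the [i]-th coordinates, turning their signed sum into the sum of
     absolute values. *)
  have := yM id K (fun s => (ss_coord SY i (y s) : R) < 0) (fun s => ltnSn s).
  apply: le_trans; apply: le_trans (ss_coord_le SY i _).
  rewrite linear_sum; apply: le_trans (ler_norm _).
  by apply: ler_sum => s _; rewrite linearZ/= -[leRHS]/(_ * _) -normrEsign.
have head m n0 : exists n, (n0 <= n)%N /\ `|ss_mask SY (gtn m) (y n)| <= c / 4.
  apply: contrapT => /forallNP bad.
  have {}bad n : (n0 <= n)%N ->
      c / 4 < \sum_(i < m) `|ss_coord SY i (y n)|.
    move=> n0n; apply: lt_le_trans (mask_head_le SY m (y n)).
    by rewrite ltNge; apply/negP => h; apply: (bad n).
  (* If all heads from [n0] on exceeded [c / 4], then [L] of them would exceed [m * M], the total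
     available to [m] coordinates. *)
  pose L := (Num.truncn (m%:R * M / (c / 4))).+1.
  have : \sum_(s < n0 + L) \sum_(i < m) `|ss_coord SY i (y s)| <= m%:R * M.
    rewrite exchange_big mulr_natl -[X in _ *+ X](card_ord m) -sumr_const.
    by apply: ler_sum => i _; exact: coordM.
  apply/negP; rewrite -ltNge.
  apply: (@lt_le_trans _ _ (L%:R * (c / 4))).
    by rewrite -ltr_pdivrMr ?divr_gt0// truncnS_gt.
  rewrite big_split_ord/= -[leLHS]add0r lerD ?sumr_ge0//.
    by move=> s _; rewrite sumr_ge0.
  rewrite mulr_natl -[X in _ *+ X](card_ord L) -sumr_const.
  by apply: ler_sum => s _; rewrite ltW// bad// leq_addr.
have step (mn : nat * nat) : exists nm : nat * nat,
    [/\ (mn.2 <= nm.1)%N, (mn.1 <= nm.2)%N &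
        c / 2 <= `|ss_mask SY [pred i | mn.1 <= i < nm.2]%N (y nm.1)|].
  have [n [n0n yn]] := head mn.1 mn.2.
  have c40 : 0 < c / 4 by rewrite divr_gt0.
  have [m ym] := ss_tail SY (y n) c40.
  exists (n, maxn mn.1 m); split => //=; first exact: leq_maxl.
  set m' := maxn mn.1 m.
  have {}ym : `|ss_mask SY (leq m') (y n)| <= c / 4.
    exact: le_trans (mask_leq_mono SY (y n) (leq_maxr mn.1 m)) ym.
  have yE : y n = ss_mask SY (gtn mn.1) (y n) +
      ss_mask SY [pred i | mn.1 <= i < m']%N (y n) + ss_mask SY (leq m') (y n).
    rewrite {1}(mask_split_leq SY m' (y n)); congr (_ + _).
    rewrite {1}(mask_split_leq SY mn.1 (ss_mask SY (gtn m') _)).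
    rewrite mask_sub_r ?ss_maskI//; move=> i /= /leq_trans; apply.
    exact: leq_maxl.
  have := yc n; rewrite {1}yE.
  have := ler_normD (ss_mask SY (gtn mn.1) (y n) +
      ss_mask SY [pred i | mn.1 <= i < m']%N (y n)) (ss_mask SY (leq m') (y n)).
  have := ler_normD (ss_mask SY (gtn mn.1) (y n))
      (ss_mask SY [pred i | mn.1 <= i < m']%N (y n)).
  by move: ym yn; lra.
have /choice[f Hf] := step.
(* The state holds the start of the next block and a lower bound for the next index; the successor
   makes [nu] strictly increasing. *)
pose st := fix st s :=
  if s is s'.+1 then ((f (st s')).2, (f (st s')).1.+1) else (0, 0)%N.
pose N s := (st s).1; pose nu s := (f (st s)).1.
have NN s : (N s <= N s.+1)%N by have [] := Hf (st s).
have nun s : (nu s < nu s.+1)%N by have [] := Hf (st s.+1).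
pose z s := ss_mask SY (block N s) (y (nu s)).
have zc s : c / 2 <= `|z s| by have [] := Hf (st s).
have zN s : ss_mask SY (block N s) (z s) = z s by exact: mask_sub.
have zM K : `|\sum_(s < K) z s| <= M.
  rewrite -[X in `|X|]addr0.
  (* With block projections as operators, the diagonal is the sum of the [z s]. Changing signs on
     disjoint blocks of [v] does not increase its norm, and [v] is itself a signed sum bounded by
     [M]. *)
  apply: (@diagonal_sum_le R Y Y (fun s => ss_mask SY (block N s)) (y \o nu)
    M K 0) => th tau.
  set v := \sum_(i < K) (-1) ^+ tau i *: _; rewrite addr0.
  apply: le_trans (yM nu K tau nun); rewrite -/v.
  apply: (powR_ler_inv q0) => //.
  have zE s :
      ss_mask SY (block N s) ((-1) ^+ th s *: ss_mask SY (block N s) v) =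
      (-1) ^+ th s *: ss_mask SY (block N s) v.
    by rewrite linearZ/= mask_sub.
  have /= -> := lp_block_sum NN K q0 SYq zE.
  under eq_bigr do rewrite normrZ normrX normrN1 expr1n mul1r.
  exact: lp_sum_blocks.
have c2 : 0 < (c / 2) `^ q by apply: powR_gt0; rewrite divr_gt0.
pose K := (Num.truncn (M `^ q / (c / 2) `^ q)).+1.
have : K%:R * (c / 2) `^ q <= M `^ q.
  apply: (@le_trans _ _ (`|\sum_(s < K) z s| `^ q)); last by rewrite powR_lerP.
  rewrite (lp_block_sum NN K q0 SYq zN) mulr_natl.
  rewrite -[X in _ *+ X](card_ord K) -sumr_const.
  by apply: ler_sum => s _; rewrite powR_lerP// divr_ge0// ltW.
by apply/negP; rewrite -ltNge -ltr_pdivrMr// truncnS_gt.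
Qed.

End no_c0.

(** * Sums over different rows *)

Section contraction_comp.
Context {R : realType} {X Y Z : normedModType R}.
Variables (A : compact_op Z Y) (f : {linear X -> Z}).
Hypothesis f_le : forall x, `|f x| <= `|x|.

Lemma compact_operator_comp : (fun x => A (f x)) \in compact_operator.
Proof.
have /asboolP[_ cA] := valP A; apply/asboolP; split.
  by move=> a x y; rewrite linearP linearP.
apply: precompact_subset cA => _ [x x1 <-]; exists (f x) => //.
exact: le_trans (f_le x) x1.
Qed.

Definition compact_op_comp : compact_op X Y := CompactOp compact_operator_comp.

End contraction_comp.

Section gliding_hump.
Context {R : realType} {X Y Z V : normedModType R}.
Variables (SX : seq_space R^o X) (SY : seq_space R^o Y) (SZ : seq_space X Z).
Variables (p q : R).
Hypotheses (p1 : 1 < p) (q1 : 1 < q).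
Hypotheses (SXp : lp_like p SX) (SYq : lp_like q SY) (SZ0 : c0_like SZ).
(** Abstract matrix units: each row spans an isometric copy of [l_1], and vectors from different
    rows add up as in [c_0]. They are instantiated by [unit_op]. *)
Variable e : nat -> nat -> V.
Hypothesis e_row : forall n D (a : nat -> R),
  `|\sum_(k < D) a k *: e n k| = \sum_(k < D) `|a k|.
Hypothesis e_rows : forall (nu : nat -> nat) (u : nat -> V) (K : nat),
  (forall s, (nu s < nu s.+1)%N) ->
  (forall s, exists D (a : nat -> R), u s = \sum_(k < D) a k *: e (nu s) k) ->
  (forall s, `|u s| <= 1) -> `|\sum_(s < K) u s| <= 1.
Variables (T : {linear V -> compact_op Z Y}) (M c : R).
Hypothesis M0 : 0 <= M.
Hypothesis c0 : 0 < c.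
Hypothesis T_le : forall u z, `|T u z| <= M * `|u| * `|z|.
Hypothesis T_ge : forall u (b : R), (forall z, `|z| <= 1 -> `|T u z| <= b) ->
  c * `|u| <= b.

Let e_norm n k : `|e n k| = 1.
Proof.
have := e_row n k.+1 (fun i => (i == k)%:R).
rewrite (bigD1 ord_max)//= eqxx scale1r big1 => [|i]; last first.
  by rewrite -val_eqE/= => /negPf ->; rewrite scale0r.
rewrite addr0 => ->; rewrite (bigD1 ord_max)//= eqxx normr1 big1 ?addr0// => i.
by rewrite -val_eqE/= => /negPf ->; rewrite normr0.
Qed.

(** By [small_combination], some unit vector [u] of the row has [T u] small on the first [N]
    coordinates. As [T u] has norm at least [c], it is large at some [z], and remains so after the
    head and a far tail of [z] are removed. *)
Lemma row_vector_beyond (n N : nat) : exists (u : V) (z : Z) (N' : nat),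
  [/\ (exists D (a : nat -> R), u = \sum_(k < D) a k *: e n k) /\ `|u| <= 1,
      `|z| <= 1, (N <= N')%N,
      ss_mask SZ [pred i | N <= i < N']%N z = z & c / 8 <= `|T u z|].
Proof.
pose B k (j : 'I_N) := compact_op_comp (T (e n k)) (ss_single_le SZ j).
have BM k j x : `|B k j x| <= M * `|x|.
  apply: le_trans (T_le _ _) _; rewrite e_norm mulr1.
  by rewrite ler_wpM2l// ss_single_le.
(* Summed over the [N] head coordinates, the error is at most [c / 4]. The bounds below then
   decrease from [c / 2] at [z] to [c / 4] without the head and [c / 8] without the tail. *)
have d0 : 0 < c / 4 / N.+1%:R by rewrite !divr_gt0.
have [D [a [a1 aB]]] := small_combination p1 q1 SXp SYq BM d0.
pose u := \sum_(k < D) a k *: e n k.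
have u1 : `|u| = 1 by rewrite e_row.
have TuB (j : 'I_N) x : T u (ss_single SZ j x) = (\sum_(k < D) a k *: B k j) x.
  rewrite linear_sum !compact_op_sumE; apply: eq_bigr => k _.
  by rewrite linearZ.
have Tu_head z : `|T u (ss_mask SZ (gtn N) z)| <= c / 4 * `|z|.
  rewrite ss_head linear_sum; apply: le_trans (ler_norm_sum _ _ _) _.
  apply: (@le_trans _ _ (\sum_(i < N) c / 4 / N.+1%:R * `|z|)).
    apply: ler_sum => i _; rewrite /= TuB; apply: le_trans (aB i _) _.
    by rewrite ler_wpM2l ?(ltW d0)// ss_coord_le.
  rewrite sumr_const card_ord -mulrnAl ler_wpM2r// -mulr_natr -mulrA.
  by rewrite ler_piMr ?divr_ge0 ?(ltW c0)// ler_pdivrMl// mulr1 ler_nat.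
have [z [z1 zc]] : exists z, `|z| <= 1 /\ c / 2 < `|T u z|.
  apply: contrapT => /forallNP bad.
  have : c * `|u| <= c / 2.
    apply: T_ge => z z1; rewrite leNgt; apply/negP => h.
    by apply: (bad z).
  by rewrite u1; move: c0; lra.
pose y := ss_mask SZ (leq N) z.
have yc : c / 4 < `|T u y|.
  move: zc; rewrite {1}(mask_split_leq SZ N z) linearD/=.
  have := ler_normD (T u (ss_mask SZ (gtn N) z)) (T u y).
  have := le_trans (Tu_head z) (ler_wpM2l _ z1).
  rewrite -/y mulr1 => /(_ (divr_ge0 (ltW c0) (ler0n _ _))).
  by lra.
have M1 : 0 < M + 1 by rewrite ltr_wpDl.
have t0 : 0 < c / 8 / (M + 1) by rewrite !divr_gt0.
have [m ym] := ss_tail SZ y t0.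
exists u, (ss_mask SZ (gtn (maxn N m)) y), (maxn N m); split.
- by rewrite u1; split => //; exists D, a.
- by apply: le_trans (ss_mask_le _ _ _) _; apply: le_trans (ss_mask_le _ _ _) _.
- exact: leq_maxl.
- rewrite /y !ss_maskI; apply: mask_ext => i /=.
  by case: (N <= i)%N; case: (i < maxn N m)%N.
have : `|T u (ss_mask SZ (leq (maxn N m)) y)| <= c / 8.
  apply: le_trans (T_le _ _) _; rewrite u1 mulr1.
  apply: (@le_trans _ _ ((M + 1) * (c / 8 / (M + 1)))).
    apply: ler_pM => //; last first.
      by apply: le_trans ym; apply: mask_leq_mono; exact: leq_maxr.
    by rewrite lerDl.
  by rewrite mulrC divfK// gt_eqF.
move: yc; rewrite {1}(mask_split_leq SZ (maxn N m) y) linearD/=.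
have := ler_normD (T u (ss_mask SZ (gtn (maxn N m)) y))
  (T u (ss_mask SZ (leq (maxn N m)) y)).
by lra.
Qed.

(** The pairs [u n], [z n] are chosen recursively, one in each row, with the [z n] on successive
    blocks. Signed sums of either family stay in the unit ball, so [diagonal_sum_le] bounds all
    signed sums of the vectors [T (u n) (z n)]; having norm at least [c / 8], these contradict
    [no_unconditional_bounded]. *)
Lemma no_row_embedding : False.
Proof.
have step (nN : nat * nat) : exists w : V * Z * nat,
    [/\ (exists D (a : nat -> R), w.1.1 = \sum_(k < D) a k *: e nN.1 k) /\
        `|w.1.1| <= 1,
      `|w.1.2| <= 1, (nN.2 <= w.2)%N,
      ss_mask SZ [pred i | nN.2 <= i < w.2]%N w.1.2 = w.1.2 &
      c / 8 <= `|T w.1.1 w.1.2|].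
  have [u [z [N' H]]] := row_vector_beyond nN.1 nN.2; by exists (u, z, N').
have /choice[F HF] := step.
pose N := fix N n := if n is n'.+1 then (F (n', N n')).2 else 0%N.
pose u n := (F (n, N n)).1.1; pose z n := (F (n, N n)).1.2.
have u_row n : exists D (a : nat -> R), u n = \sum_(k < D) a k *: e n k.
  by have [[]] := HF (n, N n).
have u1 n : `|u n| <= 1 by have [[]] := HF (n, N n).
have z1 n : `|z n| <= 1 by have [] := HF (n, N n).
have NN n : (N n <= N n.+1)%N by have [] := HF (n, N n).
have zN n : ss_mask SZ (block N n) (z n) = z n by have [] := HF (n, N n).
have uz n : c / 8 <= `|T (u n) (z n)| by have [] := HF (n, N n).
have c8 : 0 < c / 8 by rewrite divr_gt0.
have q0 : 0 < q by apply: lt_trans q1.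
have M1 : 0 < M + 1 by rewrite ltr_wpDl.
apply: (no_unconditional_bounded (y := fun n => T (u n) (z n)) (M := M + 1)
  q0 SYq c8 uz).
move=> nu K tau nuS.
have N_homo m n : (m <= n)%N -> (N m <= N n)%N.
  by move=> mn; apply: (homo_leq leqnn leq_trans) => // i.
(* The prescribed signs [tau] are built into the operators, so that the diagonal sum is the signed
   sum to be bounded. *)
pose S s := (-1) ^+ tau s *: T (u (nu s)).
rewrite -[X in `|X|]addr0.
apply: (@diagonal_sum_le R Z Y (fun s => S s) (z \o nu) (M + 1) K 0) => th sg.
rewrite addr0; set v := \sum_(i < K) (-1) ^+ sg i *: _.
have sgn1 (W : normedModType R) (b : bool) (w : W) : `|(-1) ^+ b *: w| = `|w|.
  by rewrite normrZ normrX normrN1 expr1n mul1r.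
have v1 : `|v| <= 1.
  (* Along the subsequence, the block of [z (nu s)] is enlarged up to [N (nu s.+1)] to obtain
     consecutive blocks. *)
  apply: (@c0_block_sum _ _ _ SZ (N \o nu) _
    (fun s => (-1) ^+ sg s *: z (nu s)) 1 K SZ0 ler01) => s /=.
  - exact/N_homo/ltnW/nuS.
  - rewrite linearZ/= -zN mask_sub// => i /andP[Ni iN].
    by apply/andP; split => //; exact: leq_trans iN (N_homo _ _ (nuS s)).
  - by rewrite sgn1.
pose w := \sum_(s < K) (-1) ^+ th s *: ((-1) ^+ tau s *: u (nu s)).
have w1 : `|w| <= 1.
  apply: (e_rows (nu := nu)
    (u := fun s => (-1) ^+ th s *: ((-1) ^+ tau s *: u (nu s)))) => //.
    move=> s; have [D [a ->]] := u_row (nu s).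
    exists D, (fun k => (-1) ^+ th s * ((-1) ^+ tau s * a k)).
    by rewrite !scaler_sumr; apply: eq_bigr => k _; rewrite !scalerA mulrA.
  by move=> s; rewrite !sgn1.
have -> : \sum_(s < K) (-1) ^+ th s *: S s v = T w v.
  rewrite [T w]linear_sum compact_op_sumE; apply: eq_bigr => s _.
  have TZ (a : R) y : T (a *: y) = a *: T y by exact: linearZ.
  by rewrite !TZ.
apply: le_trans (T_le _ _) _.
apply: (@le_trans _ _ ((M + 1) * `|w| * `|v|)).
  by rewrite !ler_wpM2r// lerDl.
apply: le_trans (ler_piMr _ v1) _; first by rewrite mulr_ge0// ltW.
by rewrite ler_piMr// ltW.
Qed.

End gliding_hump.

(** * Matrix units of [K(c_0)] and transfer along an isomorphism *)

Lemma continuous_linear_le (R : realType) (X Y : normedModType R)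
    (f : {linear X -> Y}) : continuous f ->
  exists M : R, 0 < M /\ forall x, `|f x| <= M * `|x|.
Proof.
move=> /linear_bounded_continuous/linear_boundedP[M [_ fM]].
exists (`|M| + 1); split; first by rewrite ltr_wpDl.
by apply: fM; apply: le_lt_trans (ler_norm M) _; rewrite ltrDl.
Qed.

Lemma linear_le_continuous (R : realType) (X Y : normedModType R)
    (f : {linear X -> Y}) : (forall x, `|f x| <= `|x|) -> continuous f.
Proof.
move=> fl; apply/linear_bounded_continuous/linear_boundedP.
exists 1; split => // r r1 x; apply: le_trans (fl x) _.
by rewrite ler_peMl// ltW.
Qed.

Lemma compact_op_norm_le (R : realType) (X Y : normedModType R)
    (A : compact_op X Y) (b : R) :
  (forall x, `|x| <= 1 -> `|A x| <= b) -> `|A| <= b.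
Proof. exact: op_norm_le. Qed.

Section unit_operators.
Context {R : realType}.
Local Notation c0R := (c0 (R^o : normedModType R)).
Local Notation S := (@c0_space R R^o).

(** The operator has rank at most one: it maps the unit ball into the image of [[-1, 1]] under a
    continuous map. *)
Lemma unit_op_compact (n k : nat) :
  (fun x : c0R => c0_single n (x k)) \in compact_operator.
Proof.
apply/asboolP; split; first by move=> a x y; rewrite -(c0_single_linear n).
apply: (@precompact_subset _ _ (ss_single S n @` `[(-1 : R), 1])).
  move=> _ [x x1 <-]; exists (x k) => //=.
  rewrite in_itv/= -ler_norml; exact: le_trans (c0_coord_le k x) x1.
apply: compact_precompact; first exact: norm_hausdorff.
apply: continuous_compact; last exact: segment_compact.
apply: continuous_subspaceT; apply: linear_le_continuous.
exact: ss_single_le.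
Qed.

Definition unit_op n k : compact_op c0R c0R := CompactOp (unit_op_compact n k).

Lemma row_sumE n D (a : nat -> R) (x : c0R) i :
  (\sum_(k < D) a k *: unit_op n k) x i =
  if i == n then \sum_(k < D) a k * x k else 0.
Proof.
rewrite compact_op_sumE c0_sumE.
transitivity (\sum_(k < D) if i == n then a k * x k else 0).
  apply: eq_bigr => k _; rewrite -[LHS]/(a k * (if i == n then x k else 0)).
  by case: ifP; rewrite ?mulr0.
by case: ifP => _ //; rewrite big1.
Qed.

(** The upper bound uses that coordinates in the unit ball are at most 1. It is attained at the
    sequence of signs of [a], cut off at [D] to be a null sequence. *)
Lemma row_norm n D (a : nat -> R) :
  `|\sum_(k < D) a k *: unit_op n k| = \sum_(k < D) `|a k|.
Proof.
set u := \sum_(k < D) a k *: unit_op n k.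
have sgn_null :
    (fun k => if (k < D)%N then Num.sg (a k) : R^o else 0) \in null_seq.
  apply: null_seq_eventually => e e0; exists D => k Dk.
  by rewrite ltnNge Dk normr0 ltW.
pose x : c0R := C0 sgn_null.
have x1 : `|x| <= 1.
  apply: c0_norm_le => k /=; case: ifP => _; last by rewrite normr0.
  by rewrite normr_sg; case: (_ == _).
apply: le_anti; apply/andP; split.
  apply: compact_op_norm_le => y y1; apply: c0_norm_le => i.
  rewrite row_sumE; case: ifP => _; last by rewrite normr0 sumr_ge0.
  apply: le_trans (ler_norm_sum _ _ _) _; apply: ler_sum => k _.
  rewrite normrM ler_piMr//; exact: le_trans (c0_coord_le k y) y1.
have <- : u x n = \sum_(k < D) `|a k|.
  rewrite row_sumE eqxx; apply: eq_bigr => k _ /=.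
  by rewrite ltn_ord mulrC -normrEsg.
apply: le_trans (ler_norm _) _; apply: le_trans (c0_coord_le n (u x)) _.
exact: ler_op_norm (valP u) x1.
Qed.

(** At a fixed [x], the vector [u s x] lives on the single coordinate [nu s], which lies in the
    block from [nu s] to [nu s.+1]; the sum is thus one of disjoint blocks in [c_0]. *)
Lemma rows_norm (nu : nat -> nat) (u : nat -> compact_op c0R c0R) (K : nat) :
  (forall s, (nu s < nu s.+1)%N) ->
  (forall s, exists D (a : nat -> R),
    u s = \sum_(k < D) a k *: unit_op (nu s) k) ->
  (forall s, `|u s| <= 1) -> `|\sum_(s < K) u s| <= 1.
Proof.
move=> nuS u_row u1; apply: compact_op_norm_le => x x1.
rewrite compact_op_sumE.
apply: (@c0_block_sum _ _ _ S nu _ (fun s => u s x) 1 K c0_space_like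
  ler01) => s.
- exact: ltnW.
- apply: c0_ext => i /=; case: ifP => // i_out.
  have [D [a ->]] := u_row s; rewrite row_sumE; case: eqP => // iE.
  by move: i_out; rewrite /block/= iE leqnn nuS.
- exact: le_trans (ler_op_norm (valP (u s)) x1) (u1 s).
Qed.

End unit_operators.

Theorem theorem3p2 (R : realType) (p q : R) (p1 : 1 < p) (pq : p <= q) :
  ~ exists E : submodClosed
      (compact_op (c0 (lp (ltW p1))) (lp (ltW (lt_le_trans p1 pq)))),
      isomorphic (lsubspace E) (compact_op (c0 R^o) (c0 R^o)).
Proof.
move=> [E [f [g [_ gf fc gc]]]].
have [Mf [Mf0 fM]] := continuous_linear_le fc.
have [Mg [Mg0 gM]] := continuous_linear_le gc.
(* [T] is [g] followed by the inclusion of the subspace, which is isometric. Boundedness of [g]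
   bounds [T] above, and [u = f (g u)] bounds it below by the constant [Mf^-1]. *)
pose T u := \val (g u).
have T_linear : linear T by move=> a u v; rewrite /T linearP linearP.
pose HT := GRing.isLinear.Build _ _ _ _ T T_linear.
pose LT : {linear _ -> _} := HB.pack T HT.
have T_norm u : `|T u| <= Mg * `|u| by exact: gM.
have T_norm_ge u : `|u| <= Mf * `|T u|.
  have := fM (g u); rewrite gf; exact.
apply: (@no_row_embedding R _ _ _ _ (lp_space (ltW p1))
  (lp_space (ltW (lt_le_trans p1 pq))) c0_space p q p1 (lt_le_trans p1 pq)
  (@lp_space_like R p (ltW p1)) (@lp_space_like R q _) c0_space_like
  unit_op row_norm rows_norm LT Mg Mf^-1).
- exact: ltW.
- by rewrite invr_gt0.
- move=> u z; apply: le_trans (compact_op_le (T u) z) _.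
  by apply: ler_wpM2r => //; exact: T_norm.
- move=> u b Tb; rewrite ler_pdivrMl//; apply: le_trans (T_norm_ge u) _.
  by rewrite ler_pM2l//; apply: compact_op_norm_le.
Qed.
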